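(* The $\partial_0\lambda$-calculus with tests is strongly normalizing (there is no infinite sequence of sums $\mathbb A_0\to\mathbb A_1\to\mathbb A_2\to\cdots$) and Church–Rosser (if $\mathbb A\twoheadrightarrow\mathbb B_1$ and $\mathbb A\twoheadrightarrow\mathbb B_2$ then there is $\mathbb C$ with $\mathbb B_1\twoheadrightarrow\mathbb C$ and $\mathbb B_2\twoheadrightarrow\mathbb C$).
   Context: Syntax of the $\partial_0\lambda$-calculus with tests. Terms $M,N,L$, bags $P$ and tests $V,W$ are given by $M ::= x \mid \lambda x.M \mid MP \mid \bar\tau(V)$, $P ::= [L_1,\dots,L_k]$, $V ::= \tau[L_1,\dots,L_k]$ ($k\ge 0$), where bags and tests are finite multisets of terms (the tag $\tau$ distinguishes tests from bags); expressions are taken up to $\alpha$-equivalence. $\uplus$ denotes union of bags; for tests, $\varepsilon:=\tau[\,]$ and $V\mid W$ is multiset union. For each sort, sums are finite formal sums with idempotent addition (finite sets), $0$ being the empty sum. All constructors are extended to sums by multilinearity (e.g. $\lambda x.\sum_i M_i=\sum_i\lambda x.M_i$, $(\sum_i M_i)(\sum_j P_j)=\sum_{i,j}M_iP_j$, $[\sum_i L_i]\uplus P=\sum_i[L_i]\uplus P$, $\tau[\sum_iM_i]\mid V=\sum_i\tau[M_i]\mid V$); constructors applied to $0$ give $0$. $A\{0/x\}=0$ if $x$ is free in $A$ and $A\{0/x\}=A$ otherwise. Linear substitution: $x\langle N/x\rangle=N$; $y\langle N/x\rangle=0$ for $y\neq x$; $(\lambda y.M)\langle N/x\rangle=\lambda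 y.M\langle N/x\rangle$; $(MP)\langle N/x\rangle=M\langle N/x\rangle P+M(P\langle N/x\rangle)$; $\bar\tau(V)\langle N/x\rangle=\bar\tau(V\langle N/x\rangle)$; $[L_1,\dots,L_k]\langle N/x\rangle=\sum_{i}[L_1,\dots,L_i\langle N/x\rangle,\dots,L_k]$ and likewise for tests. For $P=[L_1,\dots,L_k]$ with $x$ not free in $P$, $A\langle P/x\rangle:=A\langle L_1/x\rangle\cdots\langle L_k/x\rangle$. Reduction: base rules $(\lambda x.M)P\to M\langle P/x\rangle\{0/x\}$; $\bar\tau(V)P\to\bar\tau(V)$ if $P=[\,]$ and $\to0$ otherwise; $\tau[\lambda x.M]\mid V\to\tau[M\{0/x\}]\mid V$; $\tau[\bar\tau(V)]\mid W\to V\mid W$. The relation $\to$ on sums is the closure of these rules under every syntactic position (body of a $\lambda$, either side of an application, an element of a bag, inside $\bar\tau$, an element of a test) and under sums ($A+\mathbb B\to\mathbb A+\mathbb B$ if $A\to\mathbb A$); $\twoheadrightarrow$ is its reflexive-transitive closure.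
   Formalization: The sum rule A + B → 𝔸 + B is taken only when A is not already a summand of B; with idempotent sums and A allowed in B, τ̄(ε)[ ] → τ̄(ε) would give an infinite reduction, so strong normalization would fail. *)

(* Defs.v *)
From HB Require Import structures.
From Stdlib Require Import Relation_Operators.
From mathcomp Require Import all_boot.
From mathcomp Require Import finmap multiset.

Set Implicit Arguments.
Unset Strict Implicit.
Unset Printing Implicit Defensive.

(* Alpha-equivalence is handled by de Bruijn indices.  A raw term lists the
   elements of its bags and tests in some order; a raw bag and a raw test are
   both of type [seq rterm].  Expressions proper (type [expr] below) forget
   that order, at every depth. *)
Unset Elimination Schemes.
Inductive rterm : Type :=
| Var of nat
| Lam of rterm
| App of rterm & seq rterm
| Bar of seq rterm.
Set Elimination Schemes.

(* Induction principle for the nested type; [foldr] yields [P] for every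
   element of a list. *)
Fixpoint rterm_ind (P : rterm -> Prop)
  (PVar : forall n, P (Var n))
  (PLam : forall m, P m -> P (Lam m))
  (PApp : forall m p, P m -> foldr (fun l Q => P l /\ Q) True p -> P (App m p))
  (PBar : forall v, foldr (fun l Q => P l /\ Q) True v -> P (Bar v))
  (t : rterm) {struct t} : P t :=
  let rec := @rterm_ind P PVar PLam PApp PBar in
  let fix recs (p : seq rterm) : foldr (fun l Q => P l /\ Q) True p :=
    match p return foldr (fun l Q => P l /\ Q) True p with
    | [::] => I
    | l :: q => conj (rec l) (recs q)
    end in
  match t with
  | Var n => PVar n
  | Lam m => PLam m (rec m)
  | App m p => PApp m p (rec m) (recs p)
  | Bar v => PBar v (recs v)
  end.

Fixpoint rterm_encode (t : rterm) : GenTree.tree nat :=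
  match t with
  | Var n => GenTree.Leaf n
  | Lam m => GenTree.Node 0 [:: rterm_encode m]
  | App m p => GenTree.Node 1 (rterm_encode m :: map rterm_encode p)
  | Bar v => GenTree.Node 2 (map rterm_encode v)
  end.

Fixpoint rterm_decode (g : GenTree.tree nat) : rterm :=
  match g with
  | GenTree.Leaf n => Var n
  | GenTree.Node 0 (a :: _) => Lam (rterm_decode a)
  | GenTree.Node 1 (a :: s) => App (rterm_decode a) (map rterm_decode s)
  | GenTree.Node _ s => Bar (map rterm_decode s)
  end.

Lemma rterm_encodeK : cancel rterm_encode rterm_decode.
Proof.
have mapK p : foldr (fun l Q => rterm_decode (rterm_encode l) = l /\ Q) True p ->
    map rterm_decode (map rterm_encode p) = p.
  by elim: p => //= l q IH [-> /IH ->].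
by elim=> //= [m -> | m p -> /mapK -> | v /mapK ->].
Qed.

HB.instance Definition _ := Countable.copy rterm (can_type rterm_encodeK).

(* Multiset equality at every depth: [canon] recursively sorts all bags and
   tests along a total order on raw terms (the one given by the injection
   [pickle] into nat), so raw terms with the same canonical form are exactly
   those that differ by permutations of bags and tests; see [canon_eqE]. *)
Definition rterm_le : rel rterm := relpre choice.pickle leq.

Fixpoint canon (t : rterm) : rterm :=
  match t with
  | Var n => Var n
  | Lam m => Lam (canon m)
  | App m p => App (canon m) (path.sort rterm_le (map canon p))
  | Bar v => Bar (path.sort rterm_le (map canon v))
  end.

Definition rterm_eqv : rel rterm := fun t u => canon t == canon u.

Lemma rterm_eqv_refl : reflexive rterm_eqv.
Proof. by move=> t; rewrite /rterm_eqv. Qed.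

Lemma rterm_eqv_sym : symmetric rterm_eqv.
Proof. by move=> t u; rewrite /rterm_eqv eq_sym. Qed.

Lemma rterm_eqv_trans : transitive rterm_eqv.
Proof. by move=> t u v /eqP tu /eqP uv; rewrite /rterm_eqv tu uv. Qed.

Canonical rterm_equiv :=
  EquivRel rterm_eqv rterm_eqv_refl rterm_eqv_sym rterm_eqv_trans.

Lemma canon_eqE (t u : rterm) : rterm_eqv t u =
  match t, u with
  | Var n, Var n' => n == n'
  | Lam m, Lam m' => rterm_eqv m m'
  | App m p, App m' p' =>
      rterm_eqv m m' && perm_eq (map canon p) (map canon p')
  | Bar v, Bar v' => perm_eq (map canon v) (map canon v')
  | _, _ => false
  end.
Proof.
have sortE p q : (path.sort rterm_le p == path.sort rterm_le q) = perm_eq p q.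
  apply/eqP/idP; last move/perm_sortP; last apply; last first.
  - by move=> x y; rewrite /rterm_le /= -eqn_leq => /eqP/(pcan_inj choice.pickleK).
  - by move=> x y z; apply: leq_trans.
  - by move=> x y; apply: leq_total.
  by move=> E; rewrite -(perm_sort rterm_le) E perm_sort.
rewrite /rterm_eqv; case: t u => [n|m|m p|v] [n'|m'|m' p'|v'] //=.
- by apply/eqP/eqP => [[]|->].
- by apply/eqP/eqP => [[]|->].
- rewrite -sortE.
  by apply/eqP/andP => [[-> ->]|[/eqP -> /eqP ->]].
- by rewrite -sortE; apply/eqP/eqP => [[]|->].
Qed.

Definition term : Type := {eq_quot rterm_equiv}%qT.
HB.instance Definition _ := Choice.on term.

Inductive esort := TermS | BagS | TestS.

Definition rexpr (s : esort) : Type :=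
  match s with TermS => rterm | BagS | TestS => seq rterm end.

Definition expr (s : esort) : choiceType :=
  match s with TermS => term | BagS | TestS => {mset term}%mset end.

Definition pi_term (t : rterm) : term := (\pi_({eq_quot rterm_equiv}%qT) t)%qT.

Definition pi_expr (s : esort) : rexpr s -> expr s :=
  match s with
  | TermS => pi_term
  | BagS | TestS => fun p => seq_mset (map pi_term p)
  end.

(* Sums: idempotent addition is union, 0 is the empty set.  Below, raw sums
   are sequences of raw expressions. *)
Definition esum (s : esort) : choiceType := {fset expr s}%fset.

Definition pi_sum (s : esort) (S : seq (rexpr s)) : esum s :=
  [fset a in map (@pi_expr s) S]%fset.

Fixpoint occurs (x : nat) (t : rterm) : bool :=
  match t with
  | Var y => y == x
  | Lam m => occurs x.+1 m
  | App m p => occurs x m || has (occurs x) p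
  | Bar v => has (occurs x) v
  end.

(* [shift c] makes room for a fresh variable c; [unshift c] removes the variable
   c and is only used on terms in which c does not occur. *)
Fixpoint shift (c : nat) (t : rterm) : rterm :=
  match t with
  | Var y => Var (bump c y)
  | Lam m => Lam (shift c.+1 m)
  | App m p => App (shift c m) (map (shift c) p)
  | Bar v => Bar (map (shift c) v)
  end.

Fixpoint unshift (c : nat) (t : rterm) : rterm :=
  match t with
  | Var y => Var (unbump c y)
  | Lam m => Lam (unshift c.+1 m)
  | App m p => App (unshift c m) (map (unshift c) p)
  | Bar v => Bar (map (unshift c) v)
  end.

(* M{0/x} for x the variable 0, which leaves the scope. *)
Definition zero_subst (m : rterm) : seq rterm :=
  if occurs 0 m then [::] else [:: unshift 0 m].

(* [L_1,...,L_k] |-> sum_i [L_1,...,f(L_i),...,L_k] *)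
Definition derive_seq (f : rterm -> seq rterm) :
    seq rterm -> seq (seq rterm) :=
  fix go p :=
    match p with
    | [::] => [::]
    | l :: q => [seq l' :: q | l' <- f l] ++ [seq l :: q' | q' <- go q]
    end.

(* Linear substitution t<n/x>; x remains in scope. *)
Fixpoint lin_subst (x : nat) (n : rterm) (t : rterm) : seq rterm :=
  match t with
  | Var y => if y == x then [:: n] else [::]
  | Lam m => [seq Lam m' | m' <- lin_subst x.+1 (shift 0 n) m]
  | App m p => [seq App m' p | m' <- lin_subst x n m] ++
               [seq App m p' | p' <- derive_seq (lin_subst x n) p]
  | Bar v => [seq Bar v' | v' <- derive_seq (lin_subst x n) v]
  end.

(* m<[L_1,...,L_k]/x> = m<L_1/x>...<L_k/x>, linear substitution being extended
   to sums. *)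
Definition bag_subst (x : nat) (p : seq rterm) (m : rterm) : seq rterm :=
  foldl (fun S l => flatten [seq lin_subst x l a | a <- S]) [:: m] p.

(* One-step reduction of a raw expression to a raw sum.  Bags and tests being
   unordered, it suffices to state the rules with the active element in head
   position; see [red]. *)
Inductive rred_term : rterm -> seq rterm -> Prop :=
| RBeta m p :
    rred_term (App (Lam m) p)
      (flatten [seq zero_subst a | a <- bag_subst 0 (map (shift 0) p) m])
| RBarNil v : rred_term (App (Bar v) [::]) [:: Bar v]
| RBarCons v l p : rred_term (App (Bar v) (l :: p)) [::]
| RLam m S : rred_term m S -> rred_term (Lam m) [seq Lam m' | m' <- S]
| RAppl m p S : rred_term m S -> rred_term (App m p) [seq App m' p | m' <- S]
| RAppr m p S : rred_bag p S -> rred_term (App m p) [seq App m p' | p' <- S]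
| RBar v S : rred_test v S -> rred_term (Bar v) [seq Bar v' | v' <- S]
with rred_bag : seq rterm -> seq (seq rterm) -> Prop :=
| RBagElt l p S : rred_term l S -> rred_bag (l :: p) [seq l' :: p | l' <- S]
with rred_test : seq rterm -> seq (seq rterm) -> Prop :=
| RTestLam m v : rred_test (Lam m :: v) [seq m' :: v | m' <- zero_subst m]
| RTestBar v w : rred_test (Bar v :: w) [:: v ++ w]
| RTestElt l v S : rred_term l S -> rred_test (l :: v) [seq l' :: v | l' <- S].

Definition rred (s : esort) : rexpr s -> seq (rexpr s) -> Prop :=
  match s with
  | TermS => rred_term
  | BagS => rred_bag
  | TestS => rred_test
  end.

(* A -> S when some ordering of the bags and tests of A exhibits the redex. *)
Definition red (s : esort) (A : expr s) (S : esum s) : Prop :=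
  exists a S0, [/\ pi_expr a = A, pi_sum S0 = S & rred a S0].

(* A + B -> S + B if A -> S.  The sum A + B is split as a set, i.e. A is not a
   summand of B: otherwise, addition being idempotent, every sum containing a
   redex would be of the form A + (A + B), and could be reduced to S + (A + B),
   again containing A, and so on forever. *)
Definition sum_red (s : esort) (S S' : esum s) : Prop :=
  exists (A : expr s) (B SA : esum s),
    [/\ A \notin B, red A SA, S = (A |` B)%fset & S' = (SA `|` B)%fset].

Definition strongly_normalizing (T : Type) (R : T -> T -> Prop) : Prop :=
  forall f : nat -> T, ~ (forall n, R (f n) (f n.+1)).

Definition church_rosser (T : Type) (R : T -> T -> Prop) : Prop :=
  forall A B1 B2 : T, clos_refl_trans T R A B1 -> clos_refl_trans T R A B2 ->
  exists C : T, clos_refl_trans T R B1 C /\ clos_refl_trans T R B2 C.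

(* Main.v *)
(* Every rule consumes its redex linearly: a beta-step uses each element of the
   bag exactly once and erases the lambda, so every summand of a reduct is smaller
   than the term it comes from. Strong normalization of sums follows because a
   step of a union is a step of one or both of its parts.
   For confluence, reduction is read summand by summand. Since redexes are neither
   duplicated nor erased except in summands that vanish, two reducts of a term are
   joined in at most one step on each side. Hence "N is a summand of a normal form
   of a" does not depend on the redex fired first, so the set of all such N is
   invariant under reduction; on a normal sum it is the sum itself, and therefore
   all normal forms of a sum coincide. *)
Require Import Defs.
From Stdlib Require Import Relation_Operators Classical_Prop.
From Stdlib Require Import FunctionalExtensionality PropExtensionality.
From mathcomp Require Import all_boot finmap multiset zify.

Set Implicit Arguments.
Unset Strict Implicit.
Unset Printing Implicit Defensive.

(** The obstacle is that confluence cannot be read off sums directly: the summands of two reducts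
    may each need a different step, and they may coincide with one another or with other summands,
    in which case idempotency merges them. Joinability is therefore stated for a single summand, and
    as an inclusion only: it reduces so that everything obtained comes from summands of the other
    reduct. An equality would be too much, as a chosen summand of a substitution fixes how the bag
    is divided among the subterms, while the other reduct sums over all divisions. The invariant is
    accordingly existential (some path reaches N), and such a property passes through unions
    whatever the multiplicities. To make divisions of a bag visible, iterated linear substitution
    followed by erasure is replaced by one relation [sub]. Reduction is studied on raw terms, where
    positions make sense; permutations are factored out afterwards. *)

(** * Lists up to permutation *)

Lemma perm_map_inv (T U : eqType) (f : T -> U) s t :
  perm_eq (map f s) t -> exists2 s', perm_eq s s' & map f s' = t.
Proof.
elim: t s => [|y t IH] s Hs.
  by exists s => //; apply: perm_nilP.
have /mapP[x xs def_y]: y \in map f s by rewrite (perm_mem Hs) mem_head.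
have Hr : perm_eq (map f (rem x s)) t.
  rewrite -(perm_cons y) -(permPr Hs) perm_sym def_y -map_cons.
  exact/perm_map/perm_to_rem.
have [s' Hs' <-] := IH _ Hr; exists (x :: s'); last by rewrite def_y.
by rewrite (permPl (perm_to_rem xs)) perm_cons.
Qed.

Lemma perm_map_catP (T U : eqType) (f : T -> U) s t1 t2 :
  perm_eq (map f s) (t1 ++ t2) ->
  exists s1 s2, [/\ perm_eq s (s1 ++ s2), map f s1 = t1 & map f s2 = t2].
Proof.
case/perm_map_inv=> s' Hs Es.
exists (take (size t1) s'), (drop (size t1) s'); rewrite cat_take_drop.
by rewrite map_take map_drop Es take_size_cat ?drop_size_cat.
Qed.

Lemma perm_cons_catP (T : eqType) (x : T) s t1 t2 :
  perm_eq (x :: s) (t1 ++ t2) ->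
  (exists2 u, perm_eq t1 (x :: u) & perm_eq s (u ++ t2)) \/
  (exists2 u, perm_eq t2 (x :: u) & perm_eq s (t1 ++ u)).
Proof.
move=> Hs; have: x \in t1 ++ t2 by rewrite -(perm_mem Hs) mem_head.
rewrite mem_cat => /orP[] /perm_to_rem Ht; [left|right].
  exists (rem x t1) => //; rewrite -(perm_cons x) (permPl Hs).
  by rewrite -cat_cons perm_cat2r.
exists (rem x t2) => //; rewrite -(perm_cons x) (permPl Hs).
by rewrite perm_sym -cat1s perm_catCA perm_cat2l cat1s perm_sym.
Qed.

(** Serves to compare the positions of two redexes in the same bag or test. *)
Lemma cat_cons_eqP (T : Type) (x y : T) s1 s2 t1 t2 :
  s1 ++ x :: s2 = t1 ++ y :: t2 ->
  [\/ [/\ s1 = t1, x = y & s2 = t2],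
      exists u, t1 = s1 ++ x :: u /\ s2 = u ++ y :: t2
    | exists u, s1 = t1 ++ y :: u /\ t2 = u ++ x :: s2].
Proof.
elim: s1 t1 => [|a s1 IH] [|b t1] /=.
- by case=> -> ->; constructor 1.
- by case=> -> ->; constructor 2; exists t1.
- by case=> -> <-; constructor 3; exists s1.
case=> -> /IH[[-> -> ->]|[u [-> ->]]|[u [-> ->]]].
- by constructor 1.
- by constructor 2; exists u.
- by constructor 3; exists u.
Qed.

(** Permutations of concatenations amount to equal counts for every predicate, and these counts are
    linear. *)
Ltac perm_by_count :=
  let a := fresh "a" in
  apply/permP => a;
  repeat match goal with H : is_true (perm_eq _ _) |- _ =>
    let E := fresh "E" in
    have /permP/(_ a) E := H; clear H; revert E end;
  rewrite /= ?map_cat ?count_cat /= ?count_cat /=; lia.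

(** * Substitution of a bag *)

Lemma rterm_mem_ind (P : rterm -> Prop) :
  (forall n, P (Var n)) -> (forall m, P m -> P (Lam m)) ->
  (forall m p, P m -> (forall l, l \in p -> P l) -> P (App m p)) ->
  (forall v, (forall l, l \in v -> P l) -> P (Bar v)) -> forall t, P t.
Proof.
move=> PVar PLam PApp PBar.
have all_of p : foldr (fun l Q => P l /\ Q) True p -> forall l, l \in p -> P l.
  elim: p => //= a p IH [Pa /IH Pp] l.
  by rewrite inE => /predU1P[->|/Pp].
by elim=> [n|m IH|m p IHm /all_of IHp|v /all_of IHv]; auto.
Qed.

Lemma shift_comm c d t : c <= d ->
  shift d.+1 (shift c t) = shift c (shift d t).
Proof.
elim/rterm_mem_ind: t c d => [n|m IH|m p IHm IHp|v IH] c d cd /=.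
- by congr Var; rewrite /bump; lia.
- by rewrite IH.
- rewrite IHm // -!map_comp; congr App; apply/eq_in_map => l /IHp; exact.
- rewrite -!map_comp; congr Bar; apply/eq_in_map => l /IH; exact.
Qed.

Fixpoint rsize (t : rterm) : nat :=
  match t with
  | Var _ => 1
  | Lam m => (rsize m).+1
  | App m p => (rsize m + sumn (map rsize p)).+1
  | Bar v => (sumn (map rsize v)).+1
  end.

Lemma rsize_shift c t : rsize (shift c t) = rsize t.
Proof.
elim/rterm_mem_ind: t c => [n|m IH|m p IHm IHp|v IH] c //=.
- by rewrite IH.
- rewrite IHm -map_comp; do 3!f_equal; apply/eq_in_map => l /IHp; exact.
- rewrite -map_comp; do 2!f_equal; apply/eq_in_map => l /IH; exact.
Qed.

(** The relation [f] is a parameter outside the inner fixpoint, so that the guard condition accepts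
    the recursive calls of [sub] on the elements of a list. *)
Definition subs_of (f : seq rterm -> rterm -> rterm -> Prop) :
    seq rterm -> seq rterm -> seq rterm -> Prop :=
  fix go p q r {struct q} :=
    match q with
    | [::] => p = [::] /\ r = [::]
    | l :: q' => exists p1 p2 l' r',
        [/\ perm_eq p (p1 ++ p2), r = l' :: r', f p1 l l' & go p2 q' r']
    end.

(* [sub x p t r] : r is a summand of t<p/x>{0/x}, where x leaves the scope (p
   lives outside it).  Since every element of p is used exactly once, p is split
   among the subterms. *)
Fixpoint sub (x : nat) (p : seq rterm) (t r : rterm) {struct t} : Prop :=
  match t with
  | Var y => if y == x then p = [:: r] else p = [::] /\ r = Var (unbump x y)
  | Lam m => exists2 m', r = Lam m' & sub x.+1 (map (shift 0) p) m m'
  | App m q => exists p1 p2 m' q',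
      [/\ perm_eq p (p1 ++ p2), r = App m' q', sub x p1 m m' &
          subs_of (sub x) p2 q q']
  | Bar v => exists2 v', r = Bar v' & subs_of (sub x) p v v'
  end.

Notation subs x := (subs_of (sub x)).

Lemma subs_perm x p p' q r :
  (forall p p' l r, l \in q -> perm_eq p p' -> sub x p l r -> sub x p' l r) ->
  perm_eq p p' -> subs x p q r -> subs x p' q r.
Proof.
case: q => [|l q] _ Hp /=.
  by case=> def_p ->; split=> //; apply/perm_nilP; rewrite perm_sym -def_p.
case=> p1 [p2] [l'] [r'] [Hp1 -> Hl Hq]; exists p1, p2, l', r'; split=> //.
by rewrite -(permPl Hp).
Qed.

Lemma sub_perm x p p' t r : perm_eq p p' -> sub x p t r -> sub x p' t r.
Proof.
elim/rterm_mem_ind: t x p p' r => [n|m IH|m q IHm IHq|v IH] x p p' r Hp /=.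
- case: eqP => _ => [def_p|[def_p ->]].
    by apply/perm_small_eq; rewrite // perm_sym -def_p.
  by split=> //; apply/perm_nilP; rewrite perm_sym -def_p.
- by case=> m' -> Hm; exists m' => //; apply: IH Hm; apply: perm_map.
- case=> p1 [p2] [m'] [q'] [Hp1 -> Hm Hq]; exists p1, p2, m', q'; split=> //.
  by rewrite -(permPl Hp).
- case=> v' -> Hv; exists v' => //; apply: subs_perm Hp Hv => p1 p2 l r' lv H.
  exact: IH.
Qed.

Lemma subs_permP x p p' q r : perm_eq p p' -> subs x p q r -> subs x p' q r.
Proof. by apply: subs_perm => p1 p2 l r' _; apply: sub_perm. Qed.

Lemma subs_cat x p q1 q2 r :
  subs x p (q1 ++ q2) r <->
  exists p1 p2 r1 r2, [/\ perm_eq p (p1 ++ p2), r = r1 ++ r2,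
    subs x p1 q1 r1 & subs x p2 q2 r2].
Proof.
elim: q1 p r => [|l q1 IH] p r /=.
  split=> [H|[p1] [p2] [r1] [r2] [Hp -> [? ->]]]; first by exists [::], p, [::], r.
  by apply: subs_permP; rewrite perm_sym; subst p1.
split.
  case=> pa [pb] [l'] [r'] [Hp -> Hl /IH[pc] [pd] [r1] [r2] [Hb -> H1 H2]].
  exists (pa ++ pc), pd, (l' :: r1), r2; split=> //; first by perm_by_count.
  by exists pa, pc, l', r1.
case=> p1 [p2] [r1] [r2] [Hp -> [pa] [pb] [l'] [r'] [Hb -> Hl Hq] H2].
exists pa, (pb ++ p2), l', (r' ++ r2); split=> //; first by perm_by_count.
by apply/IH; exists pb, p2, r', r2.
Qed.

(* A substitution in a bag is a bag of substitutions, hence independent of the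
   order of the elements. *)
Lemma subsP x p q r :
  subs x p q r <->
  exists z : seq (seq rterm * (rterm * rterm)),
    [/\ q = map (fun w => w.2.1) z, r = map (fun w => w.2.2) z,
        perm_eq p (flatten (map fst z)) &
        forall w, w \in z -> sub x w.1 w.2.1 w.2.2].
Proof.
elim: q p r => [|l q IH] p r /=.
  split=> [[-> ->]|]; first by exists [::].
  by case=> [[|w z]] [] // _ -> /perm_nilP ->.
split.
  case=> p1 [p2] [l'] [r'] [Hp -> Hl /IH[z] [-> -> Hz Hw]].
  exists ((p1, (l, l')) :: z); split=> //=; first by perm_by_count.
  by move=> w; rewrite inE => /predU1P[->|/Hw].
case=> [[|[p1 [l0 l']] z]] [] // [El Eq] -> /= Hp Hw; subst l0 q.
exists p1, (flatten (map fst z)), l', [seq w.2.2 | w <- z]; split=> //.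
  by apply: (Hw (p1, (l, l'))); rewrite mem_head.
apply/IH; exists z; split=> // w wz; apply: Hw; by rewrite inE wz orbT.
Qed.

Lemma subs_perml x p q q2 r : perm_eq q q2 -> subs x p q r ->
  exists2 r2, perm_eq r r2 & subs x p q2 r2.
Proof.
move=> Hq /subsP[z] [Eq Er Hp Hw]; subst q r.
have [z2 Hz def_q2] := perm_map_inv Hq.
exists [seq w.2.2 | w <- z2]; first exact: perm_map.
apply/subsP; exists z2; split=> // [|w]; last by rewrite -(perm_mem Hz); apply: Hw.
by rewrite (permPl Hp); apply/perm_flatten/perm_map.
Qed.

Lemma subs_permr x p q r r2 : perm_eq r r2 -> subs x p q r ->
  exists2 q2, perm_eq q q2 & subs x p q2 r2.
Proof.
move=> Hr /subsP[z] [Eq Er Hp Hw]; subst q r.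
have [z2 Hz def_r2] := perm_map_inv Hr.
exists [seq w.2.1 | w <- z2]; first exact: perm_map.
apply/subsP; exists z2; split=> // [|w]; last by rewrite -(perm_mem Hz); apply: Hw.
by rewrite (permPl Hp); apply/perm_flatten/perm_map.
Qed.

Lemma subs_map x x' g h k p q r :
  (forall l p r, l \in q -> sub x p l r -> sub x' (map g p) (h l) (k r)) ->
  subs x p q r -> subs x' (map g p) (map h q) (map k r).
Proof.
elim: q p r => [|l q IH] p r Hg /=; first by case=> -> ->.
case=> p1 [p2] [l'] [r'] [Hp -> Hl Hq].
exists (map g p1), (map g p2), (k l'), (map k r'); split=> //.
- by rewrite -map_cat; apply: perm_map.
- by apply: Hg; rewrite ?mem_head.
- by apply: IH Hq => a ? ? aq; apply: Hg; rewrite inE aq orbT.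
Qed.

Lemma subs_map_inv x x' g h k p q r :
  (forall l p r, l \in q -> sub x' (map g p) (h l) r ->
     exists2 r0, r = k r0 & sub x p l r0) ->
  subs x' (map g p) (map h q) r -> exists2 r0, r = map k r0 & subs x p q r0.
Proof.
elim: q p r => [|l q IH] p r Hg /=; first by case: p => [|a p] [] // _ ->; exists [::].
case=> p1 [p2] [l'] [r'] [/perm_map_catP[pa] [pb] [Hp <- <-] -> Hl Hq].
have [l0 -> Hl0] := Hg _ _ _ (mem_head _ _) Hl.
have [|r0 -> Hr0] := IH _ _ _ Hq.
  by move=> a ? ? aq; apply: Hg; rewrite inE aq orbT.
by exists (l0 :: r0) => //; exists pa, pb, l0, r0.
Qed.

Lemma shift_shift_map d p :
  map (shift 0) (map (shift d) p) = map (shift d.+1) (map (shift 0) p).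
Proof. by rewrite -!map_comp; apply: eq_map => l /=; rewrite shift_comm. Qed.

(* Weakening commutes with substitution: c is the new variable in the scope of t,
   [bump c x] the new name of x and [unbump x c] the new variable outside the
   scope of x. *)
Lemma sub_shift x c p t r :
  sub x p t r ->
  sub (bump c x) (map (shift (unbump x c)) p) (shift c t) (shift (unbump x c) r).
Proof.
elim/rterm_mem_ind: t x c p r => [n|m IH|m q IHm IHq|v IH] x c p r /=.
- case: (n =P x) => [-> ->|nx [-> ->]]; first by rewrite eqxx.
  case: eqP => [|_]; first by rewrite /bump; lia.
  by split=> //=; congr Var; rewrite /bump /unbump; lia.
- case=> m' -> /(IH _ c.+1) Hm; exists (shift (unbump x c).+1 m') => //.
  rewrite shift_shift_map.
  have <- : unbump x.+1 c.+1 = (unbump x c).+1 by rewrite /unbump; lia.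
  by have <- : bump c.+1 x.+1 = (bump c x).+1 by rewrite /bump; lia.
- case=> p1 [p2] [m'] [q'] [Hp -> Hm Hq].
  exists (map (shift (unbump x c)) p1), (map (shift (unbump x c)) p2).
  exists (shift (unbump x c) m'), (map (shift (unbump x c)) q'); split=> //.
  + by rewrite -map_cat; apply: perm_map.
  + exact: IHm.
  + by apply: subs_map Hq => l p' r' lq; apply: IHq.
- case=> v' -> Hv; exists (map (shift (unbump x c)) v') => //.
  by apply: subs_map Hv => l p' r' lv; apply: IH.
Qed.

(** Used to leave the scope of a binder: a bag and a term that avoid a variable only give results
    that avoid it, and these descend to the smaller scope. *)
Lemma sub_shift_inv x c p t r :
  sub (bump c x) (map (shift (unbump x c)) p) (shift c t) r ->
  exists2 r0, r = shift (unbump x c) r0 & sub x p t r0.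
Proof.
elim/rterm_mem_ind: t x c p r => [n|m IH|m q IHm IHq|v IH] x c p r /=.
- have -> : (bump c n == bump c x) = (n == x) by rewrite /bump; lia.
  case: eqP => [_|nx]; first by case: p => [|a [|]] //= [<-]; exists a.
  case=> /(congr1 size); case: p => // _ ->.
  by eexists; last (split; reflexivity); congr Var; rewrite /bump /unbump; lia.
- case=> m' ->.
  rewrite shift_shift_map.
  have <- : unbump x.+1 c.+1 = (unbump x c).+1 by rewrite /unbump; lia.
  have <- : bump c.+1 x.+1 = (bump c x).+1 by rewrite /bump; lia.
  case/IH=> r0 -> Hr0; exists (Lam r0); last by exists r0.
  by congr Lam; congr shift; rewrite /unbump; lia.
- case=> p1 [p2] [m'] [q'] [/perm_map_catP[pa] [pb] [Hp <- <-] -> /IHm[m0 -> Hm]].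
  move=> Hq; have [|q0 -> {}Hq] :=
    subs_map_inv (x := x) (k := shift (unbump x c)) _ Hq.
    by move=> l p' r' lq; apply: IHq.
  by exists (App m0 q0) => //; exists pa, pb, m0, q0.
- case=> v' -> Hv; have [|v0 -> {}Hv] :=
    subs_map_inv (x := x) (k := shift (unbump x c)) _ Hv.
    by move=> l p' r' lv; apply: IH.
  by exists (Bar v0) => //; exists v0.
Qed.

(** Erasure as substitution of the empty bag: together with [sub_nil_inj], [sub x [::] t r] means
    that [t] is the weakening of [r], so x is not free in [t]. Thus M{0/x} needs no separate
    treatment. *)
Lemma sub_nil_shift x t : sub x [::] (shift x t) t.
Proof.
have subs_nil y q : (forall l, l \in q -> sub y [::] (shift y l) l) ->
    subs y [::] (map (shift y) q) q.
  elim: q => [//|l q IH] Hq; exists [::], [::], l, q; split=> //.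
    by apply: Hq; rewrite mem_head.
  by apply: IH => a aq; apply: Hq; rewrite inE aq orbT.
elim/rterm_mem_ind: t x => [n|m IH|m q IHm IHq|v IH] x /=.
- by case: eqP => [|_]; [rewrite /bump; lia | rewrite bumpK].
- by exists m => //; apply: IH.
- exists [::], [::], m, q; split=> //.
  by apply: subs_nil => l /IHq.
- by exists v => //; apply: subs_nil => l /IH.
Qed.

(** By linearity, a term without x cannot absorb any element of the bag. *)
Lemma sub_shiftE x p t r : sub x p (shift x t) r -> p = [::] /\ r = t.
Proof.
have subsE y q : (forall l, l \in q -> forall p r,
      sub y p (shift y l) r -> p = [::] /\ r = l) ->
    forall p r, subs y p (map (shift y) q) r -> p = [::] /\ r = q.
  elim: q => [//|l q IH] Hq p' r' /= [p1] [p2] [l'] [r2] [Hp -> Hl Hr].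
  have [? ->] := Hq _ (mem_head _ _) _ _ Hl.
  have [|? ->] := IH _ _ _ Hr; first by move=> a aq; apply: Hq; rewrite inE aq orbT.
  by subst p1 p2; split=> //; apply/perm_nilP.
elim/rterm_mem_ind: t x p r => [n|m IH|m q IHm IHq|v IH] x p r /=.
- case: eqP => [|_]; first by rewrite /bump; lia.
  by rewrite bumpK.
- by case=> m' -> /IH[/(congr1 size)]; case: p => // _ ->.
- case=> p1 [p2] [m'] [q'] [Hp -> /IHm[? ->] /subsE[l lq p' r' |? ->]].
    exact: IHq.
  by subst p1 p2; split=> //; apply/perm_nilP.
- by case=> v' -> /subsE[l lq p' r'|-> ->]; first exact: IH.
Qed.

Lemma sub_nil_inj x t r : sub x [::] t r -> t = shift x r.
Proof.
have subs_inj y q : (forall l, l \in q -> forall r,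
      sub y [::] l r -> l = shift y r) ->
    forall r, subs y [::] q r -> q = map (shift y) r.
  elim: q => [|l q IH] Hq r' /=; first by case=> _ ->.
  case=> [p1] [p2] [l'] [r2] [Hp -> Hl Hr].
  move: Hp Hl Hr; rewrite perm_sym => /perm_nilP.
  case: p1 p2 => [|//] [|//] _ /(Hq _ (mem_head _ _)) -> /= Hr.
  by rewrite -(IH _ _ Hr) // => a aq; apply: Hq; rewrite inE aq orbT.
elim/rterm_mem_ind: t x r => [n|m IH|m q IHm IHq|v IH] x r /=.
- by case: eqP => // nx [_ ->] /=; congr Var; rewrite /bump /unbump; lia.
- by case=> m' -> /IH ->.
- case=> p1 [p2] [m'] [q'] [Hp -> Hm Hq].
  move: Hp Hm Hq; rewrite perm_sym => /perm_nilP.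
  case: p1 p2 => [|//] [|//] _ /IHm -> /subs_inj -> // l lq.
  exact: IHq.
- by case=> v' -> /subs_inj -> // l lq; apply: IH.
Qed.

(** * Composition of two substitutions *)

(** The substitution lemma m<q/k><p/x> = sum of m<p1/x><q<p2/x>/k> over the divisions of p, read on
    one summand: an element of [p] lands either in a part coming from [m] or inside an inserted
    element of [q]. Since [k <= x], x is called [x.+1] as long as k is in scope. *)
Lemma sub_substitution k x q p m m2 c : k <= x ->
  sub k q m m2 -> sub x p m2 c ->
  exists p1 p2 m' q', [/\ perm_eq p (p1 ++ p2),
    sub x.+1 (map (shift k) p1) m m', subs x p2 q q' & sub k q' m' c].
Proof.
have aux u : (forall l, l \in u -> forall k x q p m2 c, k <= x ->
      sub k q l m2 -> sub x p m2 c ->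
      exists p1 p2 m' q', [/\ perm_eq p (p1 ++ p2),
        sub x.+1 (map (shift k) p1) l m', subs x p2 q q' & sub k q' m' c]) ->
    forall k x q p m2 c, k <= x -> subs k q u m2 -> subs x p m2 c ->
    exists p1 p2 m' q', [/\ perm_eq p (p1 ++ p2),
      subs x.+1 (map (shift k) p1) u m', subs x p2 q q' & subs k q' m' c].
  elim: u => [|l u IH] Hl {}k {}x {}q {}p m0 c0 kx.
    by case=> -> -> [-> ->]; exists [::], [::], [::], [::].
  case=> q1 [q2] [l2] [r2] [Hq -> H1 H2] [p1] [p2] [l3] [r3] [Hp -> H3 H4].
  have [pa [pb [l1 [qa [Ha Hl1 Hqa Hl3]]]]] := Hl _ (mem_head _ _) _ _ _ _ _ _ kx H1 H3.
  have [|pc [pd [r1 [qc [Hc Hr1 Hqc Hr3]]]]] := IH _ _ _ _ _ _ _ kx H2 H4.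
    by move=> a au; apply: Hl; rewrite inE au orbT.
  have /(subs_perml (q2 := q)) : subs x (pb ++ pd) (q1 ++ q2) (qa ++ qc).
    by apply/subs_cat; exists pb, pd, qa, qc.
  rewrite perm_sym => /(_ Hq)[q' Hq' Hs].
  exists (pa ++ pc), (pb ++ pd), (l1 :: r1), q'; split=> //.
  - by perm_by_count.
  - by exists (map (shift k) pa), (map (shift k) pc), l1, r1; rewrite map_cat.
  - by exists qa, qc, l3, r3; rewrite perm_sym.
elim/rterm_mem_ind: m k x q p m2 c => [n|m IH|m u IHm IHu|v IH] k x q p m2 c kx.
- rewrite [sub k q _ _]/=; case: (n =P k) => [-> ->|nk [-> ->]].
    (* The occurrence of k receives [m2], the only element of [q], so the whole of [p] goes into
       it. *)
    exists [::], p, (Var k), [:: c]; split=> //=; last by rewrite eqxx.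
    + case: eqP => [|_]; first by lia.
      by split=> //; congr Var; rewrite /unbump; lia.
    + by exists p, [::], c, [::]; rewrite cats0.
  rewrite /=; case: (unbump k n =P x) => [nx ->|nx [-> ->]].
    (* [c] enters the scope of k weakened, and the empty substitution for k brings it back. *)
    exists [:: c], [::], (shift k c), [::]; split=> //=.
    + have -> : (n == x.+1) by move: nx nk; rewrite /unbump; lia.
      by [].
    + exact: sub_nil_shift.
  exists [::], [::], (Var (unbump x.+1 n)), [::]; split=> //=.
  + case: eqP => [nx1|_ //]; move: nx nk; rewrite /unbump; lia.
  + case: eqP => [|_]; first by move: nx nk; rewrite /unbump; lia.
    by split=> //; congr Var; move: nx nk; rewrite /unbump; lia.
- case=> m1 -> Hm [c1] -> Hc.
  have [|pa [pb [m' [q' [Hp Hm' Hq Hc1]]]]] := IH k.+1 x.+1 _ _ _ _ _ Hm Hc.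
    by [].
  have [p1 [p2 [Hp12 Ep1 Ep2]]] := perm_map_catP Hp; subst pa pb.
  (* Neither the weakened [q] nor the weakened [p2] mentions the bound variable, so [q'] is a
     weakening and can be taken out of the lambda. *)
  have [q0 Eq Hq0] : exists2 q0, q' = map (shift 0) q0 & subs x p2 q q0.
    by apply: subs_map_inv Hq => l p' r _; apply: (@sub_shift_inv x 0).
  exists p1, p2, (Lam m'), q0; split=> //.
  + by exists m' => //; rewrite shift_shift_map.
  + by exists c1 => //; rewrite -Eq.
- case=> q1 [q2] [m1] [u1] [Hq -> H1 H2] [p1] [p2] [c1] [u3] [Hp -> H3 H4].
  have [pa [pb [l1 [qa [Ha Hl1 Hqa Hl3]]]]] := IHm _ _ _ _ _ _ kx H1 H3.
  have [pc [pd [r1 [qc [Hc Hr1 Hqc Hr3]]]]] := aux _ IHu _ _ _ _ _ _ kx H2 H4.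
  have /(subs_perml (q2 := q)) : subs x (pb ++ pd) (q1 ++ q2) (qa ++ qc).
    by apply/subs_cat; exists pb, pd, qa, qc.
  rewrite perm_sym => /(_ Hq)[q' Hq' Hs].
  exists (pa ++ pc), (pb ++ pd), (App l1 r1), q'; split=> //.
  + by perm_by_count.
  + by exists (map (shift k) pa), (map (shift k) pc), l1, r1; rewrite map_cat.
  + by exists qa, qc, c1, u3; rewrite perm_sym.
- case=> v1 -> H1 [v2 -> H2].
  have [pa [pb [l1 [qa [Ha Hl1 Hqa Hl3]]]]] := aux _ IH _ _ _ _ _ _ kx H1 H2.
  by exists pa, pb, (Bar l1), qa; split=> //; [exists l1 | exists v2].
Qed.

Lemma subs_cat_out x p q r1 r2 :
  subs x p q (r1 ++ r2) ->
  exists p1 p2 q1 q2, [/\ perm_eq p (p1 ++ p2), q = q1 ++ q2,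
    subs x p1 q1 r1 & subs x p2 q2 r2].
Proof.
elim: r1 p q => [|l r1 IH] p q /=; first by exists [::], p, [::], q.
case: q => [|l0 q] /=; first by case.
case=> pa [pb] [l'] [r'] [Hp [<- <-] Hl /IH[pc] [pd] [q1] [q2] [Hb -> H1 H2]].
exists (pa ++ pc), pd, (l0 :: q1), q2; split=> //; first by perm_by_count.
by exists pa, pc, l, r1.
Qed.

(** Converse direction: the elements of [q'] inserted for k come from elements of [q], which can be
    inserted first and receive their share of [p2] afterwards. *)
Lemma sub_substitution_inv k x p1 p2 m m' q q' c : k <= x ->
  sub x.+1 (map (shift k) p1) m m' -> subs x p2 q q' -> sub k q' m' c ->
  exists2 m2, sub k q m m2 & sub x (p1 ++ p2) m2 c.
Proof.
have aux u : (forall l, l \in u -> forall k x p1 p2 m' q q' c, k <= x ->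
      sub x.+1 (map (shift k) p1) l m' -> subs x p2 q q' -> sub k q' m' c ->
      exists2 m2, sub k q l m2 & sub x (p1 ++ p2) m2 c) ->
    forall k x p1 p2 m' q q' c, k <= x ->
      subs x.+1 (map (shift k) p1) u m' -> subs x p2 q q' -> subs k q' m' c ->
      exists2 m2, subs k q u m2 & subs x (p1 ++ p2) m2 c.
  elim: u => [|l u IH] Hl {}k {}x {}p1 {}p2 m0 {}q {}q' {}c kx.
    case=> Ep -> Hq [? ->]; subst q'; case: p1 Ep => // _.
    case: q Hq => [|a q] /=; first by case=> -> _; exists [::].
    by case=> ? [?] [?] [?] [].
  case=> pa' [pb'] [l1] [u1] [/perm_map_catP[pa] [pb] [Hp <- <-] -> H1 H2] Hq.
  case=> qa' [qb'] [l2] [u2] [Hq' -> H3 H4].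
  (* Dividing [q'] between head and tail divides [q], and with it [p2], in the same way. *)
  have [q2 Hq2 /subs_cat_out[pc [pd [qa [qb [Hp2 E H5 H6]]]]]] := subs_permr Hq' Hq.
  subst q2; have [l3 Hl3 Hl2] := Hl _ (mem_head _ _) _ _ _ _ _ _ _ _ kx H1 H5 H3.
  have [|u3 Hu3 Hu2] := IH _ _ _ _ _ _ _ _ _ kx H2 H6 H4.
    by move=> a au; apply: Hl; rewrite inE au orbT.
  exists (l3 :: u3); first by exists qa, qb, l3, u3.
  by exists (pa ++ pc), (pb ++ pd), l2, u2; split=> //; perm_by_count.
elim/rterm_mem_ind: m k x p1 p2 m' q q' c
  => [n|m IH|m u IHm IHu|v IH] k x p1 p2 m' q q' c kx.
- rewrite [sub x.+1 _ _ _]/=; case: (n =P x.+1) => [->|nx].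
    case: p1 => [|a [|]] //= [<-] Hq /sub_shiftE[? ->]; subst q'.
    case: q Hq => [|b q] /=; last by case=> ? [?] [?] [?] [].
    case=> -> _; have -> : (x.+1 == k) = false by lia.
    exists (Var x); first by split=> //; congr Var; rewrite /unbump; lia.
    by rewrite /= eqxx.
  case=> /(congr1 size); case: p1 => // _ ->; rewrite /=.
  have -> : (unbump x.+1 n == k) = (n == k) by move: nx; rewrite /unbump; lia.
  case: (n =P k) => nk Hq Hc.
    subst q'; case: q Hq => [|b [|b' q]] /=; first by case.
      case=> pa [pb] [l'] [r'] [Hp [<- <-] Hb [? _]]; exists b => //.
      by apply: sub_perm Hb; rewrite perm_sym; subst pb; rewrite cats0 in Hp.
    by case=> ? [?] [?] [?] [_ [_ <-] _ [?] [?] [?] [?] []].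
  case: Hc => ? ->; subst q'; case: q Hq => [|b q] /=; last by case=> ? [?] [?] [?] [].
  case=> -> _; exists (Var (unbump k n)) => //.
  rewrite /=; case: eqP => [|_]; first by move: nx nk; rewrite /unbump; lia.
  by split=> //; congr Var; move: nx nk; rewrite /unbump; lia.
- rewrite [sub x.+1 _ _ _]/=; case=> m1 -> Hm Hq [c1] -> Hc.
  rewrite shift_shift_map in Hm.
  have Hq1 : subs x.+1 (map (shift 0) p2) (map (shift 0) q) (map (shift 0) q').
    by apply: subs_map Hq => l p' r _; apply: (@sub_shift x 0).
  have [//|m2 Hm2 Hc2] := IH k.+1 x.+1 _ _ _ _ _ _ _ Hm Hq1 Hc.
  by exists (Lam m2); [exists m2 | exists c1; rewrite // map_cat].
- case=> pa' [pb'] [l1] [u1] [/perm_map_catP[pa] [pb] [Hp <- <-] -> H1 H2] Hq.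
  case=> qa' [qb'] [l2] [u2] [Hq' -> H3 H4].
  have [q2 Hq2 /subs_cat_out[pc [pd [qa [qb [Hp2 E H5 H6]]]]]] := subs_permr Hq' Hq.
  subst q2; have [l3 Hl3 Hl2] := IHm _ _ _ _ _ _ _ _ kx H1 H5 H3.
  have [u3 Hu3 Hu2] := aux _ IHu _ _ _ _ _ _ _ _ kx H2 H6 H4.
  exists (App l3 u3); first by exists qa, qb, l3, u3.
  by exists (pa ++ pc), (pb ++ pd), l2, u2; split=> //; perm_by_count.
- case=> v1 -> H1 H2 [v2 -> H3].
  have [v3 H4 H5] := aux _ IH _ _ _ _ _ _ _ _ kx H1 H2 H3.
  by exists (Bar v3); [exists v3 | exists v2].
Qed.

Lemma sumn_rsize_shift c p :
  sumn (map rsize (map (shift c) p)) = sumn (map rsize p).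
Proof. by rewrite -map_comp; congr sumn; apply: eq_map => l /=; rewrite rsize_shift. Qed.

(** Each element of [p] replaces one occurrence of a variable, which has size 1. The size of the bag
    being already counted in a beta-redex, the reduct is smaller at least by the application and the
    lambda. *)
Lemma sub_rsize x p t r :
  sub x p t r -> rsize r + size p = rsize t + sumn (map rsize p).
Proof.
have aux y u : (forall l, l \in u -> forall p r, sub y p l r ->
      rsize r + size p = rsize l + sumn (map rsize p)) ->
    forall p r, subs y p u r ->
    sumn (map rsize r) + size p = sumn (map rsize u) + sumn (map rsize p).
  elim: u => [|l u IH] Hl p' r' /=; first by case=> -> ->.
  case=> p1 [p2] [l'] [u'] [Hp -> /(Hl _ (mem_head _ _)) H1 /IH H2].
  have {}H2 := H2 (fun a au => Hl a (@mem_behead _ (l :: u) a au)).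
  have H3 := perm_size Hp; have H4 := perm_sumn (perm_map rsize Hp).
  by move: H3 H4; rewrite /= size_cat map_cat sumn_cat; lia.
elim/rterm_mem_ind: t x p r => [n|m IH|m u IHm IHu|v IH] x p r /=.
- by case: eqP => [_ ->|_ [-> ->]] //=; rewrite addn0 addnC.
- by case=> m' -> /IH; rewrite size_map sumn_rsize_shift /=; lia.
- case=> p1 [p2] [l'] [u'] [Hp -> /IHm H1 /aux H2].
  have {}H2 := H2 (fun a au => IHu a au _).
  have H3 := perm_size Hp; have H4 := perm_sumn (perm_map rsize Hp).
  by move: H3 H4; rewrite /= size_cat map_cat sumn_cat; lia.
- by case=> v' -> /aux H; have /= {}H := H (fun a av => IH a av _); lia.
Qed.

(** * Reduction summand by summand *)

Definition img (T U : Type) (K : T -> U) (S : T -> Prop) : U -> Prop :=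
  fun r => exists2 l, S l & r = K l.

(** Sets of summands are predicates; turning extensional equality into equality allows rewriting the
    index of [step]. *)
Lemma pred_ext (T : Type) (S S' : T -> Prop) : (forall r, S r <-> S' r) -> S = S'.
Proof.
move=> H; apply: functional_extensionality => r.
exact: propositional_extensionality.
Qed.

Lemma img_comp (T U V : Type) (K : U -> V) (L : T -> U) S :
  img K (img L S) = img (fun l => K (L l)) S.
Proof.
apply: pred_ext => r; split=> [[_ [l Sl ->] ->]|[l Sl ->]]; first by exists l.
by exists (L l) => //; exists l.
Qed.

Lemma img_eq (T U : Type) (K : T -> U) t : img K (eq t) = eq (K t).
Proof. by apply: pred_ext => r; split=> [[_ <- ->]|<-] //; exists t. Qed.

(* One-step reduction of a raw term to the set of summands of its reduct.  Unlike
   in [rred_term], the active element of a bag or test may be at any position;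
   [tstep] reduces an element of a test to a piece of test. *)
Inductive step : rterm -> (rterm -> Prop) -> Prop :=
| step_beta m p : step (App (Lam m) p) (sub 0 p m)
| step_bar_nil v : step (App (Bar v) [::]) (eq (Bar v))
| step_bar_cons v l p : step (App (Bar v) (l :: p)) (fun _ => False)
| step_lam m S : step m S -> step (Lam m) (img Lam S)
| step_appl m p S : step m S -> step (App m p) (img (fun m' => App m' p) S)
| step_appr m p1 l p2 S : step l S ->
    step (App m (p1 ++ l :: p2)) (img (fun l' => App m (p1 ++ l' :: p2)) S)
| step_bar v1 l v2 S : tstep l S ->
    step (Bar (v1 ++ l :: v2)) (img (fun s => Bar (v1 ++ s ++ v2)) S)
with tstep : rterm -> (seq rterm -> Prop) -> Prop :=
| tstep_lam m : tstep (Lam m) (img (fun m' => [:: m']) (sub 0 [::] m))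
| tstep_bar v : tstep (Bar v) (eq v)
| tstep_elt l S : step l S -> tstep l (img (fun l' => [:: l']) S).

Scheme step_tstep_ind := Minimality for step Sort Prop
with tstep_step_ind := Minimality for tstep Sort Prop.
Combined Scheme step_mutind from step_tstep_ind, tstep_step_ind.

(** Inversion with explicit equations, so that two steps from the same application can be compared
    by crossing the cases. *)
Variant app_step (m : rterm) (p : seq rterm) (S : rterm -> Prop) : Prop :=
| AppBeta m0 of m = Lam m0 & S = sub 0 p m0
| AppBarNil v of m = Bar v & p = [::] & S = eq (Bar v)
| AppBarCons v l q of m = Bar v & p = l :: q & S = (fun _ => False)
| AppL S' of step m S' & S = img (fun m' => App m' p) S'
| AppR p1 l p2 S' of p = p1 ++ l :: p2 & step l S' &
    S = img (fun l' => App m (p1 ++ l' :: p2)) S'.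

Lemma step_appP m p S : step (App m p) S -> app_step m p S.
Proof.
by inversion 1; subst; [eapply AppBeta | eapply AppBarNil | eapply AppBarCons
  | eapply AppL | eapply AppR]; eauto.
Qed.

Lemma step_lamP m S : step (Lam m) S -> exists2 S', step m S' & S = img Lam S'.
Proof. by inversion 1; exists S0. Qed.

Lemma step_barP v S : step (Bar v) S ->
  exists v1 l v2 S', [/\ v = v1 ++ l :: v2, tstep l S' &
    S = img (fun s => Bar (v1 ++ s ++ v2)) S'].
Proof. by inversion 1; exists v1, l, v2, S0. Qed.

Variant tstep_spec l (S : seq rterm -> Prop) : Prop :=
| TstepLam m of l = Lam m & S = img (fun m' => [:: m']) (sub 0 [::] m)
| TstepBar v of l = Bar v & S = eq v
| TstepElt S' of step l S' & S = img (fun l' => [:: l']) S'.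

Lemma tstepP l S : tstep l S -> tstep_spec l S.
Proof.
by inversion 1; subst; [eapply TstepLam | eapply TstepBar | eapply TstepElt]; eauto.
Qed.

Lemma step_rsize :
  (forall a S, step a S -> forall b, S b -> rsize b < rsize a) /\
  (forall l S, tstep l S -> forall s, S s -> sumn (map rsize s) < rsize l).
Proof.
apply: step_mutind => //=.
- by move=> m p b /sub_rsize; lia.
- by move=> v b <- /=; lia.
- by move=> m S _ IH b [m' /IH H ->].
- by move=> m p S _ IH b [m' /IH H ->] /=; lia.
- move=> m p1 l p2 S _ IH b [l' /IH H ->] /=.
  by rewrite !map_cat !sumn_cat /=; lia.
- move=> v1 l v2 S _ IH b [s /IH H ->] /=.
  by rewrite !map_cat !sumn_cat /=; lia.
- by move=> m s [m' /sub_rsize H ->] /=; move: H; rewrite /=; lia.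
- by move=> v s ->.
- by move=> l S _ IH s [l' /IH H ->] /=; lia.
Qed.

(** * Steps under contexts and substitutions *)

(** A semantic notion of one-hole context. It also covers contexts that weaken what is put under
    their binders, such as those left by a substitution. *)
Definition stable (K : rterm -> rterm) : Prop :=
  forall l S, step l S -> step (K l) (img K S).

Lemma stable_bar v1 v2 : stable (fun l => Bar (v1 ++ l :: v2)).
Proof.
move=> l S /tstep_elt/(step_bar v1 v2); rewrite img_comp; exact.
Qed.

Lemma sub0_shift c p m :
  img (shift c) (sub 0 p m) = sub 0 (map (shift c) p) (shift c.+1 m).
Proof.
have Ec : unbump 0 c.+1 = c by rewrite /unbump; lia.
apply: pred_ext => r; rewrite -{1 2}Ec; split=> [[r' Hr ->]|].
  exact: (@sub_shift 0 c.+1).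
by case/(@sub_shift_inv 0 c.+1) => r0 ->; exists r0.
Qed.

(** Substitution weakens an element of the bag whenever it passes a lambda; the redexes of that
    element must survive. *)
Lemma step_shift :
  (forall a S, step a S -> forall c, step (shift c a) (img (shift c) S)) /\
  (forall l S, tstep l S -> forall c, tstep (shift c l) (img (map (shift c)) S)).
Proof.
apply: step_mutind => /=.
- by move=> m p c; rewrite sub0_shift; apply: step_beta.
- by move=> v c; rewrite img_eq; apply: step_bar_nil.
- move=> v l p c; have -> : img (shift c) (fun _ => False) = (fun _ => False).
    by apply: pred_ext => r; split=> // -[].
  exact: step_bar_cons.
- by move=> m S _ IH c; have /step_lam := IH c.+1; rewrite !img_comp.
- by move=> m p S _ IH c; have /(step_appl (map (shift c) p)) := IH c; rewrite !img_comp.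
- move=> m p1 l p2 S _ IH c.
  have /(step_appr (shift c m) (map (shift c) p1) (map (shift c) p2)) := IH c.
  rewrite !img_comp map_cat /=; congr step.
  by apply: pred_ext => r; split=> -[l' Sl ->]; exists l'; rewrite //= map_cat.
- move=> v1 l v2 S _ IH c.
  have /(step_bar (map (shift c) v1) (map (shift c) v2)) := IH c.
  rewrite !img_comp map_cat /=; congr step.
  by apply: pred_ext => r; split=> -[l' Sl ->]; exists l'; rewrite //= !map_cat.
- move=> m c; have := tstep_lam (shift c.+1 m).
  by rewrite -[[::]]/(map (shift c) [::]) -sub0_shift !img_comp.
- by move=> v c; rewrite img_eq; apply: tstep_bar.
- by move=> l S _ IH c; have /tstep_elt := IH c; rewrite !img_comp.
Qed.

(* Linearity: an element l of the substituted bag lands at exactly one place of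
   the result, in a context K which does not depend on l. *)
Lemma sub_hole x l q t b : sub x (l :: q) t b ->
  exists K, [/\ b = K l, stable K & forall l', sub x (l' :: q) t (K l')].
Proof.
have aux y u : (forall a, a \in u -> forall l q b, sub y (l :: q) a b ->
      exists K, [/\ b = K l, stable K & forall l', sub y (l' :: q) a (K l')]) ->
    forall l q b, subs y (l :: q) u b ->
    exists b1 K b2, [/\ b = b1 ++ K l :: b2, stable K &
      forall l', subs y (l' :: q) u (b1 ++ K l' :: b2)].
  elim: u => [|a u IH] Ha {}l {}q {}b /=; first by case.
  case=> p1 [p2] [a'] [b'] [/perm_cons_catP[[q1 Hp1 Hq]|[q2 Hp2 Hq]] -> H1 H2].
    have [K [-> HK HsK]] := Ha _ (mem_head _ _) _ _ _ (sub_perm Hp1 H1).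
    exists [::], K, b'; split=> // l'; exists (l' :: q1), p2, (K l'), b'.
    by rewrite /= perm_cons.
  have [|b1 [K [b2 [-> HK HsK]]]] := IH _ _ _ _ (subs_permP Hp2 H2).
    by move=> c cu; apply: Ha; rewrite inE cu orbT.
  exists (a' :: b1), K, b2; split=> // l'.
  exists p1, (l' :: q2), a', (b1 ++ K l' :: b2); split=> //.
  by perm_by_count.
elim/rterm_mem_ind: t x l q b => [n|m IH|m u IHm IHu|v IH] x l q b /=.
- case: eqP => [_ [-> ->]|_ []//].
  by exists id; split=> // a S; rewrite /img => Ha; congr step: Ha;
    apply: pred_ext => r; split=> [|[? ? ->]] //; exists r.
- case=> m' -> /IH[K [-> HK HsK]].
  exists (fun a => Lam (K (shift 0 a))); split=> // [a S Ha|l'].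
    by have := step_lam (HK _ _ (step_shift.1 _ _ Ha 0)); rewrite !img_comp.
  by exists (K (shift 0 l')).
- case=> p1 [p2] [a'] [b'] [/perm_cons_catP[[q1 Hp1 Hq]|[q2 Hp2 Hq]] -> H1 H2].
    have [K [-> HK HsK]] := IHm _ _ _ _ (sub_perm Hp1 H1).
    exists (fun l => App (K l) b'); split=> // [a S /HK/(step_appl b')|l'].
      by rewrite img_comp.
    by exists (l' :: q1), p2, (K l'), b'; rewrite /= perm_cons.
  have [|b1 [K [b2 [-> HK HsK]]]] := aux _ _ _ _ _ _ (subs_permP Hp2 H2).
    by move=> c cu; apply: IHu.
  exists (fun l => App a' (b1 ++ K l :: b2)).
  split=> // [a S /HK/(step_appr a' b1 b2)|l']; first by rewrite img_comp.
  exists p1, (l' :: q2), a', (b1 ++ K l' :: b2); split=> //.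
  by perm_by_count.
- case=> v' -> /aux[a av|b1 [K [b2 [-> HK HsK]]]]; first exact: IH.
  exists (fun l => Bar (b1 ++ K l :: b2)).
  split=> // [a S /HK/(stable_bar b1 b2)|l']; first by rewrite img_comp.
  by exists (b1 ++ K l' :: b2).
Qed.

Lemma subs_mid x p u1 w u2 r :
  subs x p (u1 ++ w ++ u2) r <->
  exists p1 pw p2 r1 rw r2, [/\ perm_eq p (p1 ++ pw ++ p2), r = r1 ++ rw ++ r2 &
    [/\ subs x p1 u1 r1, subs x pw w rw & subs x p2 u2 r2]].
Proof.
split.
  case/subs_cat=> p1 [p'] [r1] [r'] [Hp -> H1].
  case/subs_cat=> pw [p2] [rw] [r2] [Hp' -> Hw H2].
  by exists p1, pw, p2, r1, rw, r2; split=> //; perm_by_count.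
case=> p1 [pw] [p2] [r1] [rw] [r2] [Hp -> [H1 Hw H2]].
apply/subs_cat; exists p1, (pw ++ p2), r1, (rw ++ r2); split=> //.
by apply/subs_cat; exists pw, p2, rw, r2.
Qed.

Lemma subs_seq1 x p l r :
  subs x p [:: l] r <-> exists2 l', r = [:: l'] & sub x p l l'.
Proof.
split=> [[p1] [p2] [l'] [r'] [Hp -> Hl [? ->]]|[l' -> Hl]].
  exists l' => //; apply: sub_perm Hl; subst p2.
  by rewrite perm_sym; rewrite cats0 in Hp.
by exists p, [::], l', [::]; rewrite cats0.
Qed.

Lemma sub_bar_nil_app x p v b : sub x p (App (Bar v) [::]) b <->
  exists2 v', b = App (Bar v') [::] & subs x p v v'.
Proof.
split=> /= [[p1] [p2] [m'] [q'] [Hp -> [v' -> Hv] [? ->]]|[v' -> Hv]].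
  exists v' => //; apply: subs_permP Hv; subst p2.
  by rewrite perm_sym; rewrite cats0 in Hp.
by exists p, [::], (Bar v'), [::]; rewrite cats0; split=> //; exists v'.
Qed.

(** A redex of [m] survives, as substitution only fills variables. The reduct [T] is merely included
    in the substituted [S]: [b] fixes how [p] is divided, while the latter allows every division. *)
Lemma step_sub :
  (forall m S, step m S -> forall x p b, sub x p m b ->
     exists2 T, step b T & forall c, T c -> exists2 m2, S m2 & sub x p m2 c) /\
  (forall l S, tstep l S -> forall x p b, sub x p l b ->
     exists2 T, tstep b T & forall s, T s -> exists2 s2, S s2 & subs x p s2 s).
Proof.
apply: step_mutind.
- move=> m q x p b [p1] [p2] [m'] [q'] [Hp -> [m0 -> Hm] Hq].
  exists (sub 0 q' m0) => [|c Hc]; first exact: step_beta.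
  (* Beta commutes with the outer substitution by the substitution lemma. *)
  have [m2 H1 H2] := sub_substitution_inv (leq0n x) Hm Hq Hc.
  by exists m2 => //; apply: sub_perm H2; rewrite perm_sym.
- move=> v x p b /sub_bar_nil_app[v' -> Hv].
  exists (eq (Bar v')) => [|c <-]; first exact: step_bar_nil.
  by exists (Bar v) => //; exists v'.
- move=> v l q x p b [p1] [p2] [m'] [q'] [_ -> [v' -> _] [p3] [p4] [l'] [r'] [_ -> _ _]].
  by exists (fun _ => False) => //; apply: step_bar_cons.
- move=> m S _ IH x p b [m' -> /IH[T HT TS]].
  exists (img Lam T) => [|_ [c /TS[m2 Sm Hm] ->]]; first exact: step_lam.
  by exists (Lam m2); [exists m2 | exists c].
- move=> m q S _ IH x p b [p1] [p2] [m'] [q'] [Hp -> /IH[T HT TS] Hq].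
  exists (img (App^~ q') T) => [|_ [c /TS[m2 Sm Hm] ->]]; first exact: step_appl.
  by exists (App m2 q); [exists m2 | exists p1, p2, c, q'].
- move=> m q1 l q2 S _ IH x p b [p1] [p2] [m'] [q'] [Hp -> Hm].
  case/(@subs_mid x p2 q1 [:: l]) => pa [pl] [pc] [ra] [rl] [rc] [Hp2 -> [Ha]].
  case/subs_seq1=> l' -> /IH[T HT TS] Hc.
  exists (img (fun l' => App m' (ra ++ l' :: rc)) T); first exact: step_appr.
  move=> _ [c /TS[l2 Sl Hl] ->]; exists (App m (q1 ++ l2 :: q2)); first by exists l2.
  exists p1, p2, m', (ra ++ c :: rc); split=> //.
  apply/(@subs_mid x p2 q1 [:: l2]); exists pa, pl, pc, ra, [:: c], rc.
  by split=> //; split=> //; apply/subs_seq1; exists c.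
- move=> v1 l v2 S _ IH x p b [v'] ->.
  case/(@subs_mid x p v1 [:: l]) => pa [pl] [pc] [ra] [rl] [rc] [Hp -> [Ha]].
  case/subs_seq1=> l' -> /IH[T HT TS] Hc.
  exists (img (fun s => Bar (ra ++ s ++ rc)) T); first exact: step_bar.
  move=> _ [s /TS[s2 Ss Hs] ->]; exists (Bar (v1 ++ s2 ++ v2)); first by exists s2.
  exists (ra ++ s ++ rc) => //.
  by apply/subs_mid; exists pa, pl, pc, ra, s, rc.
- move=> m x p b [m' -> Hm]; exists (img (fun m' => [:: m']) (sub 0 [::] m')).
    exact: tstep_lam.
  move=> _ [c Hc ->].
  have [//|m2 H1 H2] := sub_substitution_inv (p2 := [::]) (q := [::]) (leq0n x) Hm _ Hc.
  exists [:: m2]; first by exists m2.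
  by apply/subs_seq1; exists c; rewrite // cats0 in H2 *.
- move=> v x p b [v' -> Hv]; exists (eq v') => [|_ <-]; first exact: tstep_bar.
  by exists v.
- move=> l S _ IH x p b /IH[T HT TS].
  exists (img (fun l' => [:: l']) T) => [|_ [c /TS[l2 Sl Hl] ->]]; first exact: tstep_elt.
  by exists [:: l2]; [exists l2 | apply/subs_seq1; exists c].
Qed.

(** The other half of compatibility with substitution: when [b] ranges over all divisions of [p], no
    summand of the substituted reduct is missed. *)
Lemma step_sub_back :
  (forall m S, step m S -> forall x p m2 c, S m2 -> sub x p m2 c ->
     exists b T, [/\ sub x p m b, step b T & T c]) /\
  (forall l S, tstep l S -> forall x p s2 s, S s2 -> subs x p s2 s ->
     exists b T, [/\ sub x p l b, tstep b T & T s]).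
Proof.
apply: step_mutind.
- move=> m q x p m2 c H1 H2.
  have [p1 [p2 [m' [q' [Hp Hm Hq Hc]]]]] := sub_substitution (leq0n x) H1 H2.
  exists (App (Lam m') q'), (sub 0 q' m'); split=> //; last exact: step_beta.
  by exists p1, p2, (Lam m'), q'; split=> //; exists m'.
- move=> v x p _ c <- [v' -> Hv]; exists (App (Bar v') [::]), (eq (Bar v')).
  by split=> //; [apply/sub_bar_nil_app; exists v' | apply: step_bar_nil].
- by [].
- move=> m S _ IH x p _ _ [m2 Sm ->] [c -> /(IH _ _ _ _ Sm)[b [T [Hb HT Tc]]]].
  exists (Lam b), (img Lam T); split; first by exists b.
    exact: step_lam.
  by exists c.
- move=> m q S _ IH x p _ _ [m2 Sm ->] [p1] [p2] [c] [q'] [Hp ->].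
  case/(IH _ _ _ _ Sm)=> b [T [Hb HT Tc]] Hq.
  exists (App b q'), (img (App^~ q') T); split; first by exists p1, p2, b, q'.
    exact: step_appl.
  by exists c.
- move=> m q1 l q2 S _ IH x p _ _ [l2 Sl ->] [p1] [p2] [m'] [q'] [Hp -> Hm].
  case/(@subs_mid x p2 q1 [:: l2]) => pa [pl] [pc] [ra] [rl] [rc] [Hp2 -> [Ha]].
  case/subs_seq1=> c -> /(IH _ _ _ _ Sl)[b [T [Hb HT Tc]]] Hc.
  exists (App m' (ra ++ b :: rc)), (img (fun l' => App m' (ra ++ l' :: rc)) T).
  split; last by exists c.
    exists p1, p2, m', (ra ++ b :: rc); split=> //.
    apply/(@subs_mid x p2 q1 [:: l]); exists pa, pl, pc, ra, [:: b], rc.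
    by split=> //; split=> //; apply/subs_seq1; exists b.
  exact: step_appr.
- move=> v1 l v2 S _ IH x p _ _ [s2 Ss ->] [v'] ->.
  case/subs_mid => pa [pl] [pc] [ra] [s] [rc] [Hp -> [Ha]].
  case/(IH _ _ _ _ Ss)=> b [T [Hb HT Ts]] Hc.
  exists (Bar (ra ++ b :: rc)), (img (fun s => Bar (ra ++ s ++ rc)) T).
  split; last by exists s.
    exists (ra ++ b :: rc) => //.
    apply/(@subs_mid x p v1 [:: l]); exists pa, pl, pc, ra, [:: b], rc.
    by split=> //; split=> //; apply/subs_seq1; exists b.
  exact: step_bar.
- move=> m x p _ _ [m2 Hm ->] /subs_seq1[c -> Hc].
  have [p1 [p2 [m' [q' [Hp Hm' [? ?] Hc']]]]] := sub_substitution (leq0n x) Hm Hc.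
  subst p2 q'; exists (Lam m'), (img (fun m' => [:: m']) (sub 0 [::] m')).
  split; [exists m' => //| exact: tstep_lam | by exists c].
  by apply: sub_perm Hm'; rewrite cats0 in Hp; rewrite perm_sym; apply: perm_map.
- move=> v x p _ v' <- Hv; exists (Bar v'), (eq v').
  by split=> //; [exists v' | apply: tstep_bar].
- move=> l S _ IH x p _ _ [l2 Sl ->] /subs_seq1[c -> /(IH _ _ _ _ Sl)[b [T [Hb HT Tc]]]].
  by exists b, (img (fun l' => [:: l']) T); split=> //; [apply: tstep_elt | exists c].
Qed.

(** * Joining two reducts of a term *)

Definition rstep (b : rterm) (T : rterm -> Prop) : Prop := step b T \/ T = eq b.

(* The summand b of one reduct of a term can be reduced so that it is covered by
   (reducts of) summands of another reduct S. *)
Definition joins (b : rterm) (S : rterm -> Prop) : Prop :=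
  exists2 T, rstep b T & forall c, T c ->
    exists b2 T2, [/\ S b2, rstep b2 T2 & T2 c].

Lemma joins_refl b (S : rterm -> Prop) : S b -> joins b S.
Proof.
move=> Sb; exists (eq b) => [|_ <-]; first by right.
by exists b, (eq b); split=> //; right.
Qed.

Lemma rstep_stable K b T : stable K -> rstep b T -> rstep (K b) (img K T).
Proof. by move=> HK [/HK|->]; [left | right; rewrite img_eq]. Qed.

Lemma joins_stable K b S : stable K -> joins b S -> joins (K b) (img K S).
Proof.
move=> HK [T HT TS]; exists (img K T) => [|_ [c /TS[b2 [T2 [Sb HT2 Tc]]] ->]].
  exact: rstep_stable.
exists (K b2), (img K T2); split; [by exists b2 | exact: rstep_stable | by exists c].
Qed.

Lemma joins_img_ext (T : Type) b (K K' : T -> rterm) S :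
  K =1 K' -> joins b (img K S) -> joins b (img K' S).
Proof. by move=> /functional_extensionality ->. Qed.

(** Redexes side by side: [K] has a hole for each, with [t0] and [u0] the parts before reduction.
    Firing one leaves the other in place, so each reduct needs one more step. *)
Lemma joins_commute (T U : Type) (K : T -> U -> rterm) t0 u0 S1 S2 t :
  (forall t, step (K t u0) (img (K t) S2)) ->
  (forall u, step (K t0 u) (img (K^~ u) S1)) ->
  S1 t -> joins (K t u0) (img (K t0) S2).
Proof.
move=> H2 H1 S1t; exists (img (K t) S2) => [|_ [u S2u ->]]; first by left.
exists (K t0 u), (img (K^~ u) S1).
by split; [exists u | left | exists t].
Qed.

(** One summand [b] of [S1] is enough: later only a single path to a normal summand is followed. *)
Definition diamond_at (a : rterm) : Prop :=
  forall S1 S2 b, step a S1 -> step a S2 -> S1 b -> joins b S2.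

(** The overlaps at one element of a test are a test rule at its root against a step inside its
    lambda or its inner test. *)
Lemma tstep_diamond l v1 v2 S1 S2 s : diamond_at l ->
  tstep l S1 -> tstep l S2 -> S1 s ->
  joins (Bar (v1 ++ s ++ v2)) (img (fun s => Bar (v1 ++ s ++ v2)) S2).
Proof.
move=> Hl /tstepP[m El ->|v El ->|S1' HS1 ->] /tstepP[m' El' ->|v' El' ->|S2' HS2 ->];
  try (subst l => //).
- by case: El' => -> Hs; apply: joins_refl; exists s.
- case: (step_lamP HS2) => S HS -> [m1 Hm ->].
  (* Erasure commutes with a step of the body, being substitution of the empty bag. *)
  have [T HT TS] := step_sub.1 _ _ HS _ _ _ Hm.
  exists (img (fun l => Bar (v1 ++ l :: v2)) T); first by left; apply: stable_bar.
  move=> _ [c /TS[m2 Sm Hc] ->].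
  exists (Bar (v1 ++ Lam m2 :: v2)).
  eexists; split; last first; [|left; apply/step_bar/tstep_lam|].
  + by exists [:: c] => //; exists c.
  + by exists [:: Lam m2] => //; exists (Lam m2) => //; exists m2.
- by case: El' => -> Hs; apply: joins_refl; exists s.
- move=> <-; case: (step_barP HS2) => u1 [l] [u2] [S [-> HS ->]].
  (* Once the inner test is spliced in, its redex stands between [v1 ++ u1] and [u2 ++ v2]. *)
  exists (img (fun s => Bar ((v1 ++ u1) ++ s ++ (u2 ++ v2))) S).
    by left; rewrite -!catA /= catA; apply: step_bar.
  move=> _ [c Sc ->]; exists (Bar (v1 ++ Bar (u1 ++ c ++ u2) :: v2)).
  eexists; split; last first; [|left; apply/step_bar/tstep_bar|].
  + by exists (u1 ++ c ++ u2) => //; rewrite -!catA.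
  + exists [:: Bar (u1 ++ c ++ u2)] => //; exists (Bar (u1 ++ c ++ u2)) => //.
    by exists c.
- case: (step_lamP HS1) => S HS -> [_ [m2 Sm ->] ->].
  exists (img (fun s => Bar (v1 ++ s ++ v2)) (img (fun m' => [:: m']) (sub 0 [::] m2))).
    by left; apply/step_bar/tstep_lam.
  move=> _ [_ [c Hc ->] ->].
  have [b [T [Hb HT Tc]]] := step_sub_back.1 _ _ HS _ _ _ _ Sm Hc.
  exists (Bar (v1 ++ b :: v2)), (img (fun l => Bar (v1 ++ l :: v2)) T).
  split; [|left; exact: stable_bar|by exists c].
  by exists [:: b] => //; exists b.
- case: (step_barP HS1) => u1 [l] [u2] [S [-> HS ->]] [_ [c Sc ->] ->].
  exists (img (fun s => Bar (v1 ++ s ++ v2)) (eq (u1 ++ c ++ u2))).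
    by left; apply/step_bar/tstep_bar.
  move=> _ [_ <- ->].
  exists (Bar (v1 ++ (u1 ++ l :: u2) ++ v2)).
  exists (img (fun s => Bar ((v1 ++ u1) ++ s ++ (u2 ++ v2))) S).
  split; first by exists (u1 ++ l :: u2).
    by left; rewrite -!catA /= catA; apply: step_bar.
  by exists c => //; rewrite -!catA.
- case=> b S1b ->; rewrite img_comp.
  exact: (joins_stable (@stable_bar v1 v2) (Hl _ _ _ HS1 HS2 S1b)).
Qed.

(** Contexts that agree pointwise are equal by extensionality; this absorbs the reassociation of
    lists around the hole. *)
Lemma step_bar_at v1 l v2 v (K : seq rterm -> rterm) S :
  v = v1 ++ l :: v2 -> (forall s, K s = Bar (v1 ++ s ++ v2)) -> tstep l S ->
  step (Bar v) (img K S).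
Proof.
move=> -> HK Hl; have -> : K = (fun s => Bar (v1 ++ s ++ v2)).
  exact: functional_extensionality.
exact: step_bar.
Qed.

Lemma step_appr_at m p1 l p2 p (K : rterm -> rterm) S :
  p = p1 ++ l :: p2 -> (forall l', K l' = App m (p1 ++ l' :: p2)) -> step l S ->
  step (App m p) (img K S).
Proof.
move=> -> HK Hl; have -> : K = (fun l' => App m (p1 ++ l' :: p2)).
  exact: functional_extensionality.
exact: step_appr.
Qed.

Lemma bar_diamond v : (forall l, l \in v -> diamond_at l) -> diamond_at (Bar v).
Proof.
move=> IH S1 S2 b /step_barP[v1 [l1 [v2 [S1' [E1 H1 ->]]]]].
case/step_barP=> u1 [l2] [u2] [S2' [E2 H2 ->]] [s S1s ->].
have E : v1 ++ l1 :: v2 = u1 ++ l2 :: u2 by rewrite -E1.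
case: (cat_cons_eqP E) => [[? ? ?]|[w [? ?]]|[w [? ?]]]; subst.
- by apply: tstep_diamond H1 H2 S1s; apply: IH; rewrite mem_cat mem_head orbT.
(* The holes take lists, since a test rule may replace an element by several or by none. *)
- pose K s s' := Bar (v1 ++ s ++ w ++ s' ++ u2).
  have H : joins (K s [:: l2]) (img (K [:: l1]) S2').
    apply: (@joins_commute _ _ K _ _ S1') => // t.
    + by apply: (@step_bar_at (v1 ++ t ++ w) l2 u2) => // *; rewrite /K -?catA.
    + exact: (@step_bar_at v1 l1 (w ++ t ++ u2)).
  by apply: joins_img_ext H => s0; rewrite /K -catA.
- pose K s s' := Bar (u1 ++ s' ++ w ++ s ++ v2).
  have H : joins (K s [:: l2]) (img (K [:: l1]) S2').
    apply: (@joins_commute _ _ K _ _ S1') => // t.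
    + exact: (@step_bar_at u1 l2 (w ++ t ++ v2)).
    + by apply: (@step_bar_at (u1 ++ t ++ w) l1 v2) => // *; rewrite /K -?catA.
  by rewrite -catA.
Qed.

(** The critical pairs are beta against a step in the body, settled by compatibility with
    substitution; beta against a step in the bag, settled by linearity; and the rules for [Bar]
    against inner steps. *)
Lemma app_diamond m p : diamond_at m -> (forall l, l \in p -> diamond_at l) ->
  diamond_at (App m p).
Proof.
move=> IHm IHp S1 S2 b.
case/step_appP=> [m1 Em ->|v Em Ep ->|v l q Em Ep ->|S1' H1 ->|p1 l p2 S1' Ep H1 ->];
case/step_appP=> [m1' Em' ->|v' Em' Ep' ->|v' l' q' Em' Ep' ->|S2' H2 ->
  |p1' l' p2' S2' Ep' H2 ->];
  try by [|subst].
- by case: (etrans (esym Em) Em') => ->; apply: joins_refl.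
- move=> Hb; subst m; case: (step_lamP H2) => S HS ->.
  have [T HT TS] := step_sub.1 _ _ HS _ _ _ Hb.
  exists T => [|c /TS[m2 Sm Hc]]; first by left.
  exists (App (Lam m2) p), (sub 0 p m2); split=> //; last by left; apply: step_beta.
  by exists (Lam m2) => //; exists m2.
- move=> Hb; subst m p.
  (* [sub_hole] follows the head of the bag, so the active element is moved there. *)
  have Hp a : perm_eq (p1' ++ a :: p2') (a :: p1' ++ p2').
    by rewrite -cat1s perm_catCA.
  have [K [-> HK HsK]] := sub_hole (sub_perm (Hp l') Hb).
  exists (img K S2') => [|_ [c Sc ->]]; first by left; apply: HK.
  exists (App (Lam m1) (p1' ++ c :: p2')), (sub 0 (p1' ++ c :: p2') m1).
  split; [by exists c | by left; apply: step_beta | ].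
  by apply: sub_perm (HsK c); rewrite perm_sym.
- by case: (etrans (esym Em) Em') => ->; apply: joins_refl.
- move=> <-; subst m p; exists S2' => [|c Sc]; first by left.
  case: (step_barP H2) Sc => v1 [l0] [v2] [S [_ _ ->]] [s Ss ->].
  exists (App (Bar (v1 ++ s ++ v2)) [::]), (eq (Bar (v1 ++ s ++ v2))).
  split=> //; last by left; apply: step_bar_nil.
  by exists (Bar (v1 ++ s ++ v2)) => //; exists s.
- by move: Ep'; rewrite Ep; case: (p1').
- subst m; case: (step_lamP H1) => S HS -> [_ [m2 Sm ->] ->].
  exists (sub 0 p m2) => [|c Hc]; first by left; apply: step_beta.
  have [b' [T [Hb' HT Tc]]] := step_sub_back.1 _ _ HS _ _ _ _ Sm Hc.
  by exists b', T; split=> //; left.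
- subst m p; case: (step_barP H1) => v1 [l] [v2] [S [_ _ E]] [m' Sm ->].
  have [v Ev] : exists v, m' = Bar v.
    by move: Sm; rewrite E => -[s _ ->]; exists (v1 ++ s ++ v2).
  exists (eq m') => [|_ <-]; first by left; rewrite Ev; apply: step_bar_nil.
  by exists (Bar v'), S1'; split=> //; left.
- subst m p; case: (step_barP H1) => v1 [l0] [v2] [S [_ _ ->]] [m' [s _ ->] ->].
  by exists (fun _ => False) => //; left; apply: step_bar_cons.
- case=> m' Sm ->; apply: joins_stable (IHm _ _ _ H1 H2 Sm) => l S.
  exact: step_appl.
- subst p => -[m' Sm ->].
  apply: (@joins_commute _ _ (fun m l => App m (p1' ++ l :: p2')) m l' S1') => //.
    by move=> t; apply: step_appr.
  by move=> u; apply: step_appl.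
- subst m p => -[c Sc ->].
  have Hp a : perm_eq (p1 ++ a :: p2) (a :: p1 ++ p2).
    by rewrite -cat1s perm_catCA.
  exists (sub 0 (p1 ++ c :: p2) m1') => [|r Hr]; first by left; apply: step_beta.
  have [K [-> HK HsK]] := sub_hole (sub_perm (Hp c) Hr).
  exists (K l), (img K S1'); split; [|left; exact: HK|by exists c].
  by apply: sub_perm (HsK l); rewrite perm_sym.
- by move: Ep'; rewrite Ep; case: (p1).
(* A step inside a nonempty bag leaves it nonempty, so this summand vanishes as well. *)
- subst m; case=> c Sc ->; exists (fun _ => False) => //; left.
  by case: (p1) => [|a p0]; apply: step_bar_cons.
- subst p => -[c Sc ->].
  apply: (@joins_commute _ _ (fun l m => App m (p1 ++ l :: p2)) l m S1') => //.
    by move=> t; apply: step_appl.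
  by move=> u; apply: step_appr.
- have E : p1 ++ l :: p2 = p1' ++ l' :: p2' by rewrite -Ep.
  case=> c Sc ->.
  case: (cat_cons_eqP E) => [[? ? ?]|[w [? ?]]|[w [? ?]]]; subst.
  + apply: joins_stable (IHp l' _ _ _ _ H1 H2 Sc) => [l S|].
      exact: step_appr.
    by rewrite mem_cat mem_head orbT.
  + pose K l l' := App m (p1 ++ l :: w ++ l' :: p2').
    have H : joins (K c l') (img (K l) S2').
      apply: (@joins_commute _ _ K _ _ S1') => // t.
      * by apply: (@step_appr_at m (p1 ++ t :: w) l' p2') => // *; rewrite /K -?catA.
      * exact: (@step_appr_at m p1 l (w ++ t :: p2')).
    by apply: joins_img_ext H => l0; rewrite /K -catA.
  + pose K l l' := App m (p1' ++ l' :: w ++ l :: p2).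
    have H : joins (K c l') (img (K l) S2').
      apply: (@joins_commute _ _ K _ _ S1') => // t.
      * exact: (@step_appr_at m p1' l' (w ++ t :: p2)).
      * by apply: (@step_appr_at m (p1' ++ t :: w) l p2) => // *; rewrite /K -?catA.
    by rewrite -catA.
Qed.

Lemma diamond a : diamond_at a.
Proof.
elim/rterm_mem_ind: a => [n|m IH|m p IHm IHp|v IH].
- by inversion 1.
- move=> S1 S2 b /step_lamP[S1' H1 ->] /step_lamP[S2' H2 ->] [m' Sm ->].
  by apply: joins_stable (IH _ _ _ H1 H2 Sm) => l S; apply: step_lam.
- exact: app_diamond.
- exact: bar_diamond.
Qed.

(** * Invariance of normal forms *)

Definition normal (a : rterm) : Prop := forall S, ~ step a S.

(* [has_nf N a] : N is a summand of the normal form of a. *)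
Inductive has_nf (N : rterm) : rterm -> Prop :=
| has_nf_normal a : normal a -> canon a = canon N -> has_nf N a
| has_nf_step a S b : step a S -> S b -> has_nf N b -> has_nf N a.

Lemma normal_has_nf N a : normal a -> has_nf N a -> canon a = canon N.
Proof. by move=> Ha HN; case: HN Ha => // {}a S b HS _ _ /(_ _ HS). Qed.

(** Newman's argument by induction on size, along one path. If N is reached through [b], the diamond
    gives a step of [b] into summands covered by [S]; by induction one of them, [c], still reaches
    N, and [c] is obtained from some element of [S]. *)
Lemma has_nf_reduct N a S : step a S -> has_nf N a -> exists2 b, S b & has_nf N b.
Proof.
have [n] := ubnP (rsize a); elim: n a S => // n IH a S Hn HS HN.
case: HN HS Hn => {}a => [Ha _ /Ha //|S' b HS' S'b HN HS Hn].
have [T HT TS] := diamond HS' HS S'b.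
have [c Tc Hc] : exists2 c, T c & has_nf N c.
  case: HT => [HT|->]; last by exists b.
  by apply: IH HT HN; have := step_rsize.1 _ _ HS' _ S'b; lia.
have [b2 [T2 [Sb2 HT2 T2c]]] := TS _ Tc; exists b2 => //.
case: HT2 T2c => [HT2 T2c|-> ->] //; exact: has_nf_step HT2 T2c Hc.
Qed.

(** * Invariance under permutations of bags and tests *)

Definition seqv (p q : seq rterm) : bool := perm_eq (map canon p) (map canon q).

Lemma seqv_sym p q : seqv p q = seqv q p.
Proof. exact: perm_sym. Qed.

Lemma seqv_cat p1 p2 q1 q2 : seqv p1 q1 -> seqv p2 q2 -> seqv (p1 ++ p2) (q1 ++ q2).
Proof. by rewrite /seqv !map_cat; apply: perm_cat. Qed.

Lemma perm_seqv p q : perm_eq p q -> seqv p q.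
Proof. exact: perm_map. Qed.

Lemma seqv_trans p q r : seqv p q -> seqv q r -> seqv p r.
Proof. exact: perm_trans. Qed.

Lemma canon_appP m p t : canon (App m p) = canon t ->
  exists m' p', [/\ t = App m' p', canon m = canon m' & seqv p p'].
Proof.
move/eqP; rewrite -[_ == _]/(rterm_eqv _ _) canon_eqE.
by case: t => // m' p' /andP[/eqP Hm Hp]; exists m', p'.
Qed.

Lemma canon_barP v t : canon (Bar v) = canon t ->
  exists2 v', t = Bar v' & seqv v v'.
Proof.
move/eqP; rewrite -[_ == _]/(rterm_eqv _ _) canon_eqE.
by case: t => // v' Hv; exists v'.
Qed.

Lemma canon_lamP m t : canon (Lam m) = canon t ->
  exists2 m', t = Lam m' & canon m = canon m'.
Proof. by case: t => // m' [Hm]; exists m'. Qed.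

Lemma canon_varP n t : canon (Var n) = canon t -> t = Var n.
Proof. by case: t => // n' [->]. Qed.

Lemma canon_app m m' p p' : canon m = canon m' -> seqv p p' ->
  canon (App m p) = canon (App m' p').
Proof.
move=> Hm Hp; apply/eqP; rewrite -[_ == _]/(rterm_eqv _ _) canon_eqE.
by rewrite /rterm_eqv Hm eqxx.
Qed.

Lemma canon_bar v v' : seqv v v' -> canon (Bar v) = canon (Bar v').
Proof. by move=> Hv; apply/eqP; rewrite -[_ == _]/(rterm_eqv _ _) canon_eqE. Qed.

Lemma seqv_map f p p' :
  (forall l l', l \in p -> canon l = canon l' -> canon (f l) = canon (f l')) ->
  seqv p p' -> seqv (map f p) (map f p').
Proof.
move=> Hf; rewrite seqv_sym => /perm_map_inv[q Hq Eq].
apply: (@seqv_trans _ (map f q)); last first.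
  by apply/perm_seqv/perm_map; rewrite perm_sym.
rewrite /seqv; suff -> : map canon (map f p) = map canon (map f q) by [].
elim: p q Hf Eq {Hq} => [|l p IH] [|l' q] //= Hf [E Eq]; congr cons.
  by apply: Hf; rewrite ?mem_head.
by apply: IH => // a a' ap; apply: Hf; rewrite inE ap orbT.
Qed.

Lemma canon_shift c t t' : canon t = canon t' -> canon (shift c t) = canon (shift c t').
Proof.
elim/rterm_mem_ind: t c t' => [n|m IH|m p IHm IHp|v IH] c t'.
- by move/canon_varP ->.
- by case/canon_lamP=> m' -> /IH H /=; rewrite H.
- case/canon_appP=> m' [p'] [-> /IHm Hm Hp]; apply: canon_app (Hm _) _.
  by apply: seqv_map Hp => l l' lp; apply: IHp.
- case/canon_barP=> v' -> Hv; apply: canon_bar.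
  by apply: seqv_map Hv => l l' lp; apply: IH.
Qed.

Lemma seqv_shift c p p' : seqv p p' -> seqv (map (shift c) p) (map (shift c) p').
Proof. by apply: seqv_map => l l' _; apply: canon_shift. Qed.

Lemma seqv_catP p p1 p2 : seqv p (p1 ++ p2) ->
  exists q1 q2, [/\ perm_eq p (q1 ++ q2), seqv p1 q1 & seqv p2 q2].
Proof.
rewrite /seqv map_cat => /perm_map_catP[q1 [q2 [Hp E1 E2]]].
by exists q1, q2; rewrite E1 E2.
Qed.

Lemma seqv_consP v1 l v2 v' : seqv (v1 ++ l :: v2) v' ->
  exists u1 l' u2, [/\ v' = u1 ++ l' :: u2, canon l = canon l' &
    seqv (v1 ++ v2) (u1 ++ u2)].
Proof.
move=> Hv; have : canon l \in map canon v'.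
  by rewrite -(perm_mem Hv) map_f // mem_cat mem_head orbT.
case/mapP=> l' l'v' E; case/path.splitPr: l'v' Hv => u1 u2 Hv.
exists u1, l', u2; split=> //.
by rewrite /seqv !map_cat /= E in Hv *; perm_by_count.
Qed.

Lemma seqv_mid v1 v2 u1 u2 s s' :
  seqv (v1 ++ v2) (u1 ++ u2) -> seqv s s' ->
  seqv (v1 ++ s ++ v2) (u1 ++ s' ++ u2).
Proof.
move=> Hv Hs; have H w1 w2 w3 : seqv (w1 ++ w2 ++ w3) (w2 ++ w1 ++ w3).
  by apply: perm_seqv; rewrite perm_catCA.
apply: seqv_trans (H _ _ _) _; rewrite seqv_sym.
by apply: seqv_trans (H _ _ _) _; rewrite seqv_sym; apply: seqv_cat.
Qed.

(** Permuting subterms or the bag only rearranges the division of [p]; the choices that produced [r]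
    are carried along. *)
Lemma sub_canon x p p' t t' r : sub x p t r -> canon t = canon t' -> seqv p p' ->
  exists2 r', sub x p' t' r' & canon r = canon r'.
Proof.
have aux y u : (forall l, l \in u -> forall p p' l' r, sub y p l r ->
      canon l = canon l' -> seqv p p' ->
      exists2 r', sub y p' l' r' & canon r = canon r') ->
    forall p p' u' r, subs y p u r -> seqv u u' -> seqv p p' ->
    exists2 r', subs y p' u' r' & seqv r r'.
  move=> Hl {}p {}p' u' {}r Hr; rewrite seqv_sym => /perm_map_inv[u2 Hu2 E] Hp.
  suff [r2 H1 H2] : exists2 r', subs y p' u2 r' & seqv r r'.
    rewrite perm_sym in Hu2; have [r3 Hr3 H3] := subs_perml Hu2 H1.
    by exists r3 => //; apply: seqv_trans H2 (perm_seqv Hr3).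
  elim: u u2 p p' r Hl Hr E Hp {Hu2} => [|l u IH] [|l2 u2] //= {}p {}p' {}r Hl.
    case=> -> -> _; rewrite seqv_sym => /perm_nilP.
    by case: p' => // _; exists [::].
  case=> p1 [p2] [l'] [r'] [Hp -> H1 H2] [E Eu] Hpp'.
  have Hp' : seqv p' (p1 ++ p2).
    by rewrite seqv_sym in Hpp'; apply: seqv_trans Hpp' (perm_seqv Hp).
  have [q1 [q2 [Hq Hpq1 Hpq2]]] := seqv_catP Hp'.
  have [l3 Hl3 El3] := Hl _ (mem_head _ _) _ _ _ _ H1 (esym E) Hpq1.
  have [|r3 Hr3 Er3] := IH _ _ _ _ _ H2 Eu Hpq2.
    by move=> a au; apply: Hl; rewrite inE au orbT.
  exists (l3 :: r3); first by exists q1, q2, l3, r3.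
  by rewrite /seqv /= El3 perm_cons.
elim/rterm_mem_ind: t x p p' t' r => [n|m IH|m q IHm IHq|v IH] x p p' t' r.
- move=> Hr /canon_varP -> Hp; move: Hr => /=; case: eqP => [_ Ep|_ [Ep ->]]; subst p.
    case: p' Hp => [|r' [|? ?]] /=; [by move/perm_size| |by move/perm_size].
    by move/perm_consP=> [i [u [E _]]]; exists r' => //; case: i E => [|i] [].
  rewrite seqv_sym in Hp; case: p' Hp => [|a p'] /perm_size // _.
  by exists (Var (unbump x n)).
- case=> m1 -> Hm /canon_lamP[m' -> E] Hp.
  have [m2 Hm2 Em2] := IH _ _ _ _ _ Hm E (seqv_shift 0 Hp).
  by exists (Lam m2); [exists m2 | rewrite /= Em2].
- case=> p1 [p2] [m1] [q1] [Hpp -> Hm Hq] /canon_appP[m' [q' [-> Em Eq]]] Hp.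
  have Hp' : seqv p' (p1 ++ p2).
    by rewrite seqv_sym in Hp; apply: seqv_trans Hp (perm_seqv Hpp).
  have [pa [pb [Hab Ha Hb]]] := seqv_catP Hp'.
  have [m2 Hm2 Em2] := IHm _ _ _ _ _ Hm Em Ha.
  have [q2 Hq2 Eq2] := aux _ _ (fun l lq => IHq l lq x) _ _ _ _ Hq Eq Hb.
  by exists (App m2 q2); [exists pa, pb, m2, q2 | apply: canon_app].
- case=> v1 -> Hv /canon_barP[v' -> Ev] Hp.
  have [v2 Hv2 Ev2] := aux _ _ (fun l lq => IH l lq x) _ _ _ _ Hv Ev Hp.
  by exists (Bar v2); [exists v2 | apply: canon_bar].
Qed.

Definition covers (T : Type) (R : T -> T -> Prop) (S S' : T -> Prop) : Prop :=
  forall b, S b -> exists2 b', S' b' & R b b'.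

(** Makes reduction independent of the orderings chosen for bags and tests: a permutation moves a
    redex without destroying it. The reducts agree as sets up to permutation, hence the two
    inclusions. *)
Lemma step_canon :
  (forall a S, step a S -> forall a', canon a = canon a' -> exists2 S', step a' S' &
     covers (fun b b' => canon b = canon b') S S' /\
     covers (fun b b' => canon b = canon b') S' S) /\
  (forall l S, tstep l S -> forall l', canon l = canon l' ->
     exists2 S', tstep l' S' & covers seqv S S' /\ covers seqv S' S).
Proof.
apply: step_mutind.
- move=> m p a' /canon_appP[m0 [p' [-> /canon_lamP[m' -> Em] Ep]]].
  exists (sub 0 p' m'); first exact: step_beta.
  split=> b Hb; first by have [b' H E] := sub_canon Hb Em Ep; exists b'.
  by rewrite seqv_sym in Ep; have [b' H E] := sub_canon Hb (esym Em) Ep; exists b'.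
- move=> v a' /canon_appP[m0 [p' [-> /canon_barP[v' -> Ev] /perm_size]]].
  case: p' => // _; exists (eq (Bar v')); first exact: step_bar_nil.
  split=> _ <-; [exists (Bar v') | exists (Bar v)] => //; apply: canon_bar => //.
  by rewrite seqv_sym.
- move=> v l p a' /canon_appP[m0 [p' [-> /canon_barP[v' -> Ev] /perm_size]]].
  case: p' => // l' p' _; exists (fun _ => False); first exact: step_bar_cons.
  by split=> b [].
- move=> m S _ IH a' /canon_lamP[m' -> /IH[S' HS' [H1 H2]]].
  exists (img Lam S'); first exact: step_lam.
  split=> _ [b Sb ->].
    by have [b' Sb' E] := H1 _ Sb; exists (Lam b'); [exists b' | rewrite /= E].
  by have [b' Sb' E] := H2 _ Sb; exists (Lam b'); [exists b' | rewrite /= E].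
- move=> m p S _ IH a' /canon_appP[m' [p' [-> /IH[S' HS' [H1 H2]] Ep]]].
  exists (img (App^~ p') S'); first exact: step_appl.
  split=> _ [b Sb ->].
    have [b' Sb' E] := H1 _ Sb; exists (App b' p'); first by exists b'.
    exact: canon_app.
  have [b' Sb' E] := H2 _ Sb; exists (App b' p); first by exists b'.
  by apply: canon_app; rewrite // seqv_sym.
- move=> m p1 l p2 S _ IH a' /canon_appP[m' [p' [-> Em]]].
  case/seqv_consP=> u1 [l'] [u2] [-> /IH[S' HS' [H1 H2]] Ep].
  exists (img (fun l' => App m' (u1 ++ l' :: u2)) S'); first exact: step_appr.
  split=> _ [b Sb ->].
    have [b' Sb' E] := H1 _ Sb; exists (App m' (u1 ++ b' :: u2)); first by exists b'.
    apply: canon_app => //; rewrite -!(cat1s _ p2) -!(cat1s _ u2).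
    by apply: seqv_mid; rewrite // /seqv /= E.
  have [b' Sb' E] := H2 _ Sb; exists (App m (p1 ++ b' :: p2)); first by exists b'.
  rewrite seqv_sym in Ep; apply: canon_app => //.
  rewrite -!(cat1s _ p2) -!(cat1s _ u2).
  by apply: seqv_mid; rewrite // /seqv /= E.
- move=> v1 l v2 S _ IH a' /canon_barP[v' ->].
  case/seqv_consP=> u1 [l'] [u2] [-> /IH[S' HS' [H1 H2]] Ev].
  exists (img (fun s => Bar (u1 ++ s ++ u2)) S'); first exact: step_bar.
  split=> _ [b Sb ->].
    have [b' Sb' E] := H1 _ Sb; exists (Bar (u1 ++ b' ++ u2)); first by exists b'.
    by apply/canon_bar/seqv_mid.
  have [b' Sb' E] := H2 _ Sb; exists (Bar (v1 ++ b' ++ v2)); first by exists b'.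
  by rewrite seqv_sym in Ev; apply/canon_bar/seqv_mid.
- move=> m l' /canon_lamP[m' -> Em].
  exists (img (fun m' => [:: m']) (sub 0 [::] m')); first exact: tstep_lam.
  split=> _ [b Hb ->].
    have [b' H E] := sub_canon Hb Em (perm_refl _); exists [:: b']; first by exists b'.
    by rewrite /seqv /= E.
  have [b' H E] := sub_canon Hb (esym Em) (perm_refl _).
  by exists [:: b']; [exists b' | rewrite /seqv /= E].
- move=> v l' /canon_barP[v' -> Ev]; exists (eq v'); first exact: tstep_bar.
  by split=> _ <-; [exists v' | exists v; rewrite // seqv_sym].
- move=> l S _ IH l' /IH[S' HS' [H1 H2]].
  exists (img (fun l' => [:: l']) S'); first exact: tstep_elt.
  split=> _ [b Sb ->].
    by have [b' Sb' E] := H1 _ Sb; exists [:: b']; [exists b' | rewrite /seqv /= E].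
  by have [b' Sb' E] := H2 _ Sb; exists [:: b']; [exists b' | rewrite /seqv /= E].
Qed.

Lemma normal_canon a a' : canon a = canon a' -> normal a -> normal a'.
Proof.
by move=> E Ha S /step_canon.1 /(_ _ (esym E))[S' /Ha].
Qed.

Lemma has_nf_canon N a a' : canon a = canon a' -> has_nf N a -> has_nf N a'.
Proof.
move=> E HN; elim: HN a' E => {a} [a Ha EN|a S b HS Sb _ IH] a' E.
  by apply: has_nf_normal; [apply: normal_canon Ha | rewrite -E].
have [S' HS' [/(_ _ Sb)[b' Sb' Eb] _]] := step_canon.1 _ _ HS _ E.
exact: has_nf_step HS' Sb' (IH _ Eb).
Qed.

Lemma rsize_canon t : rsize (canon t) = rsize t.
Proof.
have sort_sumn p : sumn (map rsize (path.sort rterm_le p)) = sumn (map rsize p).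
  by apply/perm_sumn/perm_map; rewrite perm_sort.
elim/rterm_mem_ind: t => [n|m IH|m p IHm IHp|v IH] //=.
- by rewrite IH.
- by rewrite sort_sumn IHm -map_comp; do 3!f_equal; apply/eq_in_map.
- by rewrite sort_sumn -map_comp; do 2!f_equal; apply/eq_in_map.
Qed.

(** * Comparison with the raw rules and sums *)

Lemma occurs_shift x t : occurs x (shift x t) = false.
Proof.
elim/rterm_mem_ind: t x => [n|m IH|m p IHm IHp|v IH] x /=.
- by rewrite /bump; lia.
- exact: IH.
- rewrite IHm has_map; apply/hasPn => l lp /=; by rewrite IHp.
- by rewrite has_map; apply/hasPn => l lp /=; rewrite IH.
Qed.

Lemma shiftK x : cancel (shift x) (unshift x).
Proof.
move=> t; elim/rterm_mem_ind: t x => [n|m IH|m p IHm IHp|v IH] x /=.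
- by rewrite bumpK.
- by rewrite IH.
- by rewrite IHm -map_comp; congr App; apply: map_id_in => l lp /=; apply: IHp.
- by rewrite -map_comp; congr Bar; apply: map_id_in => l lp /=; apply: IH.
Qed.

Lemma unshiftK x t : ~~ occurs x t -> shift x (unshift x t) = t.
Proof.
elim/rterm_mem_ind: t x => [n|m IH|m p IHm IHp|v IH] x /=.
- by move=> nx; congr Var; rewrite /bump /unbump; lia.
- by move/IH ->.
- rewrite negb_or => /andP[/IHm -> /hasPn Hp]; rewrite -map_comp; congr App.
  by apply: map_id_in => l lp /=; apply: IHp (Hp _ lp).
- move/hasPn=> Hv; rewrite -map_comp; congr Bar.
  by apply: map_id_in => l lp /=; apply: IH (Hv _ lp).
Qed.

Lemma mem_zero_subst t r : (r \in zero_subst t) <-> sub 0 [::] t r.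
Proof.
rewrite /zero_subst; split=> [|/sub_nil_inj ->].
  case: ifPn => // Ht; rewrite inE => /eqP ->.
  by rewrite -{1}(unshiftK Ht); apply: sub_nil_shift.
by rewrite occurs_shift shiftK mem_head.
Qed.

(** One stage of the iterated substitution. [l] is weakened because the bag in [sub] lives outside
    the scope of x; the inserted copy then avoids x, so the remaining elements cannot enter it. *)
Lemma sub_lin_subst x l q t c : sub x (l :: q) t c <->
  exists2 a, a \in lin_subst x (shift x l) t & sub x q a c.
Proof.
split.
  have aux y u : (forall a, a \in u -> forall l q c, sub y (l :: q) a c ->
        exists2 a', a' \in lin_subst y (shift y l) a & sub y q a' c) ->
      forall l q c, subs y (l :: q) u c ->
      exists2 u', u' \in derive_seq (lin_subst y (shift y l)) u & subs y q u' c.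
    elim: u => [|a u IH] Ha {}l {}q {}c /=; first by case.
    case=> p1 [p2] [a'] [u'] [/perm_cons_catP[[q1 Hp1 Hq]|[q2 Hp2 Hq]] -> H1 H2].
      have [b Hb Hbc] := Ha _ (mem_head _ _) _ _ _ (sub_perm Hp1 H1).
      exists (b :: u); first by rewrite mem_cat map_f.
      by exists q1, p2, a', u'.
    have [|b Hb Hbc] := IH _ _ _ _ (subs_permP Hp2 H2).
      by move=> b bu; apply: Ha; rewrite inE bu orbT.
    exists (a :: b); first by rewrite mem_cat map_f ?orbT.
    by exists p1, q2, a', u'.
  elim/rterm_mem_ind: t x l q c => [n|m IH|m u IHm IHu|v IH] x l q c /=.
  - case: eqP => [_ [-> ->]|_ []//]; exists (shift x c); first by rewrite mem_head.
    exact: sub_nil_shift.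
  - case=> m' -> /IH[a Ha Hm]; exists (Lam a); last by exists m'.
    by rewrite map_f // -shift_comm.
  - case=> p1 [p2] [m'] [u'] [/perm_cons_catP[[q1 Hp1 Hq]|[q2 Hp2 Hq]] -> H1 H2].
      have [b Hb Hbc] := IHm _ _ _ _ (sub_perm Hp1 H1).
      exists (App b u); first by rewrite mem_cat (map_f (App^~ u)).
      by exists q1, p2, m', u'.
    have [b Hb Hbc] := aux _ _ (fun l lu => IHu l lu x) _ _ _ (subs_permP Hp2 H2).
    exists (App m b); first by rewrite mem_cat map_f ?orbT.
    by exists p1, q2, m', u'.
  - case=> v' -> /(aux _ _ (fun l lv => IH l lv x))[b Hb Hbc].
    by exists (Bar b); [rewrite map_f | exists v'].
case=> a.
have aux y u : (forall a, a \in u -> forall l q a' c,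
      a' \in lin_subst y (shift y l) a -> sub y q a' c -> sub y (l :: q) a c) ->
    forall l q u' c, u' \in derive_seq (lin_subst y (shift y l)) u ->
    subs y q u' c -> subs y (l :: q) u c.
  elim: u => [//|b u IH] Hb {}l {}q u' {}c; rewrite mem_cat => /orP[] /mapP[b' Hb' ->].
    case=> p1 [p2] [c1] [c2] [Hp -> H1 H2]; exists (l :: p1), p2, c1, c2; split=> //.
      by rewrite /= perm_cons.
    exact: Hb (mem_head _ _) _ _ _ _ Hb' H1.
  case=> p1 [p2] [c1] [c2] [Hp -> H1 H2]; exists p1, (l :: p2), c1, c2; split=> //.
    by perm_by_count.
  by apply: IH Hb' H2 => e eu; apply: Hb; rewrite inE eu orbT.
elim/rterm_mem_ind: t x l q a c => [n|m IH|m u IHm IHu|v IH] x l q a c /=.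
- by case: eqP => // _; rewrite inE => /eqP -> /sub_shiftE[-> ->].
- case/mapP=> a' Ha -> [c' -> Hc]; exists c' => //=.
  by apply: IH Hc; rewrite shift_comm.
- rewrite mem_cat => /orP[] /mapP[b Hb ->] [p1] [p2] [c1] [c2] [Hp -> H1 H2].
    exists (l :: p1), p2, c1, c2; split=> //; first by rewrite /= perm_cons.
    exact: IHm Hb H1.
  exists p1, (l :: p2), c1, c2; split=> //; first by perm_by_count.
  exact: aux (fun l lu => IHu l lu x) _ _ _ _ Hb H2.
- case/mapP=> b Hb -> [c' -> Hc]; exists c' => //.
  exact: aux (fun l lv => IH l lv x) _ _ _ _ Hb Hc.
Qed.

Lemma mem_beta m p r :
  (r \in flatten [seq zero_subst a | a <- bag_subst 0 (map (shift 0) p) m]) <->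
  sub 0 p m r.
Proof.
(* Generalized to an arbitrary sum [S], as the fold changes its accumulator at each element. *)
have H p' S : (exists2 a, a \in foldl (fun S l => flatten [seq lin_subst 0 l a | a <- S])
      S (map (shift 0) p') & sub 0 [::] a r) <-> exists2 a, a \in S & sub 0 p' a r.
  elim: p' S => [|l p' IH] S //=; rewrite IH; split.
    case=> a /flatten_mapP[b bS Hb] Ha; exists b => //.
    by apply/sub_lin_subst; exists a.
  case=> b bS /sub_lin_subst[a Ha Hr]; exists a => //.
  by apply/flatten_mapP; exists b.
split.
  case/flatten_mapP=> a Ha /mem_zero_subst Hr.
  have /H[b] : exists2 a, a \in bag_subst 0 (map (shift 0) p) m & sub 0 [::] a r.
    by exists a.
  by rewrite inE => /eqP ->.
move=> Hr; have /H[a Ha /mem_zero_subst Hr'] : exists2 a, a \in [:: m] & sub 0 p a r.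
  by exists m; rewrite ?mem_head.
by apply/flatten_mapP; exists a.
Qed.

Scheme rred_term_mutind := Minimality for rred_term Sort Prop
with rred_bag_mutind := Minimality for rred_bag Sort Prop
with rred_test_mutind := Minimality for rred_test Sort Prop.
Combined Scheme rred_mutind from rred_term_mutind, rred_bag_mutind, rred_test_mutind.

Lemma img_mem (T U : eqType) (K : T -> U) (S : seq T) :
  img K (fun b => b \in S) = (fun b => b \in map K S).
Proof.
by apply: pred_ext => r; split=> [[l Sl ->]|/mapP[l Sl ->]]; [apply: map_f | exists l].
Qed.

(** Head position is an empty prefix for [step]. Steps of a bag are read inside an application to
    it. *)
Lemma rred_step :
  (forall a S, rred_term a S -> step a (fun b => b \in S)) /\
  (forall p S, rred_bag p S -> forall m, step (App m p) (fun b => b \in map (App m) S)) /\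
  (forall v S, rred_test v S -> step (Bar v) (fun b => b \in map Bar S)).
Proof.
apply: rred_mutind => [m p|v|v l p|m S _ IH|m p S _ IH|m p S _ IH|v S _ //
  |l p S _ IH m|m v|v w|l v S _ IH].
- have -> : (fun b => is_true (b \in flatten
      [seq zero_subst a | a <- bag_subst 0 (map (shift 0) p) m])) = sub 0 p m.
    by apply: pred_ext => r; apply: mem_beta.
  exact: step_beta.
- have -> : (fun b => is_true (b \in [:: Bar v])) = eq (Bar v).
    by apply: pred_ext => r; rewrite inE; split=> [/eqP|->].
  exact: step_bar_nil.
- have -> : (fun b => is_true (b \in [::])) = (fun _ : rterm => False).
    by apply: pred_ext => r; split.
  exact: step_bar_cons.
- by rewrite -img_mem; apply: step_lam.
- by rewrite -(img_mem (App^~ p)); apply: step_appl.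
- exact: IH.
- rewrite -map_comp -img_mem; exact: (step_appr m [::]).
- have := step_bar [::] v (tstep_lam m); congr step.
  have -> : sub 0 [::] m = (fun r => is_true (r \in zero_subst m)).
    by apply: pred_ext => r; split=> /mem_zero_subst.
  by rewrite img_comp img_mem -map_comp.
- have := step_bar [::] w (tstep_bar v); congr step.
  by rewrite img_eq /=; apply: pred_ext => r; rewrite inE; split=> [->|/eqP].
- have := step_bar [::] v (tstep_elt IH); congr step.
  by rewrite img_comp img_mem -map_comp.
Qed.

(** A permutation brings the redex to head position. The reducts are not compared: this serves only
    to show that an irreducible sum has normal summands. *)
Lemma step_rred :
  (forall a S, step a S -> exists a0 S0, canon a = canon a0 /\ rred_term a0 S0) /\
  (forall l S, tstep l S -> forall v, exists v0 S0, seqv (l :: v) v0 /\ rred_test v0 S0).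
Proof.
have Hmid u1 l l0 u2 : canon l = canon l0 -> seqv (u1 ++ l :: u2) (l0 :: u1 ++ u2).
  by move=> E; rewrite /seqv /= !map_cat /= E; perm_by_count.
apply: step_mutind.
- by move=> m p; do 2!eexists; split; [|apply: RBeta].
- by move=> v; do 2!eexists; split; [|apply: RBarNil].
- by move=> v l p; do 2!eexists; split; [|apply: RBarCons].
- move=> m S _ [m0 [S0 [E H]]]; exists (Lam m0); eexists; split; last exact: RLam H.
  by rewrite /= E.
- move=> m p S _ [m0 [S0 [E H]]]; exists (App m0 p); eexists; split; last exact: RAppl H.
  exact: canon_app E (perm_refl _).
- move=> m p1 l p2 S _ [l0 [S0 [E H]]]; exists (App m (l0 :: p1 ++ p2)); eexists.
  by split; last exact/RAppr/(RBagElt _ H); apply: canon_app (Hmid _ _ _ _ E).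
- move=> v1 l v2 S _ /(_ (v1 ++ v2))[v0 [S0 [E H]]]; exists (Bar v0); eexists.
  split; last exact: RBar H; apply: canon_bar (seqv_trans (Hmid _ _ _ _ erefl) E).
- by move=> m v; do 2!eexists; split; [|apply: RTestLam]; rewrite /seqv.
- by move=> w v; do 2!eexists; split; [|apply: RTestBar]; rewrite /seqv.
- move=> l S _ [l0 [S0 [E H]]] v; exists (l0 :: v); eexists; split.
    by rewrite /seqv /= E.
  exact: RTestElt H.
Qed.

(* Bags and tests are treated as terms whose only redexes are inside. *)
Definition embed (s : esort) : rexpr s -> rterm :=
  match s with TermS => id | BagS => App (Var 0) | TestS => Bar end.

Lemma pi_termE a b : pi_term a = pi_term b <-> canon a = canon b.
Proof. by split=> [/eqmodP/eqP|E] //; apply/eqmodP; apply/eqP. Qed.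

Lemma pi_bagE p q : perm_eq (map pi_term p) (map pi_term q) <-> seqv p q.
Proof.
have H (T U : eqType) (f : rterm -> T) (g : rterm -> U) :
    (forall a b, f a = f b -> g a = g b) ->
    perm_eq (map f p) (map f q) -> perm_eq (map g p) (map g q).
  move=> fg; rewrite perm_sym => /perm_map_inv[q' Hq E].
  apply: (@perm_trans _ (map g q')); last by apply: perm_map; rewrite perm_sym.
  suff -> : map g p = map g q' by [].
  elim: p q' E {Hq} => [|a p' IH] [|b q'] //= [/fg -> /IH -> //].
by split; apply: H => a b /pi_termE.
Qed.

Lemma pi_exprE s (a b : rexpr s) :
  pi_expr a = pi_expr b <-> canon (embed a) = canon (embed b).
Proof.
case: s a b => a b; rewrite /pi_expr /embed; first exact: pi_termE.
- split=> [/eq_seq_msetP/pi_bagE|/canon_appP[m [p [[_ ->] _ H]]]].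
    exact: canon_app.
  by apply/eq_seq_msetP/pi_bagE.
- split=> [/eq_seq_msetP/pi_bagE|/canon_barP[p [->] H]]; first exact: canon_bar.
  by apply/eq_seq_msetP/pi_bagE.
Qed.

Lemma pi_expr_surj s (A : expr s) : exists a, pi_expr a = A.
Proof.
have pi_term_surj B : exists b, pi_term b = B by exists (repr B); apply: reprK.
have pi_bag_surj (B : {mset term}%mset) : exists b, seq_mset (map pi_term b) = B.
  suff [b Eb] : exists b, map pi_term b = enum_mset B.
    by exists b; rewrite Eb seq_mset_id.
  elim: (enum_mset B) => [|C u [b Eb]]; first by exists [::].
  by have [c Ec] := pi_term_surj C; exists (c :: b); rewrite /= Ec Eb.
by case: s A => A; [apply: pi_term_surj | apply: pi_bag_surj | apply: pi_bag_surj].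
Qed.

(** Membership is tested after [embed], in lists of [rterm], uniformly in the three sorts. *)
Lemma mem_pi_sum s (S : seq (rexpr s)) B :
  B \in pi_sum S -> exists2 b, pi_expr b = B & embed b \in map (@embed s) S.
Proof.
rewrite inE; elim: S => //= b S IH; rewrite inE => /predU1P[->|/IH[b' Eb' Sb']].
  by exists b; rewrite ?mem_head.
by exists b'; rewrite // inE Sb' orbT.
Qed.

Lemma pi_sum_embed s (S : seq (rexpr s)) r :
  r \in map (@embed s) S -> exists2 b, r = embed b & pi_expr b \in pi_sum S.
Proof.
elim: S => //= b S IH; rewrite inE => /predU1P[->|/IH[b' -> Sb']];
  [exists b | exists b'] => //.
  by rewrite inE /= inE eqxx.
by move: Sb'; rewrite !inE /= => ->; rewrite orbT.
Qed.

Lemma rred_step_embed s (a : rexpr s) S :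
  rred a S -> step (embed a) (fun b => b \in map (@embed s) S).
Proof.
case: s a S => a S /= H; rewrite ?map_id.
- exact: rred_step.1.
- exact: rred_step.2.1.
- exact: rred_step.2.2.
Qed.

Lemma step_embed_red s (a : rexpr s) S :
  step (embed a) S -> exists SA, red (pi_expr a) SA.
Proof.
case: s a S => a S /= H.
- have [a0 [S0 [E H0]]] := step_rred.1 _ _ H.
  by exists (pi_sum (s := TermS) S0), a0, S0; split=> //; apply/pi_termE.
(* The head [Var 0] excludes every step except one inside the bag. *)
- case: (step_appP H) => [//|//|//|S' H' _|p1 l p2 S' Ea H' _]; first by inversion H'.
  have [l0 [S0 [E H0]]] := step_rred.1 _ _ H'.
  pose S1 : seq (rexpr BagS) := [seq l' :: p1 ++ p2 | l' <- S0].
  exists (pi_sum S1), (l0 :: p1 ++ p2), S1.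
  split; [|by [] | exact: RBagElt].
  by apply/eq_seq_msetP/pi_bagE; rewrite Ea /seqv /= !map_cat /= E; perm_by_count.
- case: (step_barP H) => v1 [l] [v2] [S' [Ea H' _]].
  have [v0 [S0 [E H0]]] := step_rred.2 _ _ H' (v1 ++ v2).
  exists (pi_sum (s := TestS) S0), v0, S0; split=> //.
  apply/eq_seq_msetP/pi_bagE; rewrite seqv_sym; apply: seqv_trans E.
  by rewrite Ea; apply: perm_seqv; rewrite -(cat1s l v2) perm_catCA.
Qed.

Lemma red_rsize s (a : rexpr s) SA B : red (pi_expr a) SA -> B \in SA ->
  exists2 b, pi_expr b = B & rsize (embed b) < rsize (embed a).
Proof.
case=> a0 [S0 [/pi_exprE E <- /rred_step_embed H]] /mem_pi_sum[b <- Sb].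
exists b => //; rewrite -(rsize_canon (embed a)) -E rsize_canon.
exact: step_rsize.1 _ _ H _ Sb.
Qed.

(** * Strong normalization of sums *)

Definition rev_sum_red (s : esort) (T S : esum s) : Prop := sum_red S T.

(* Lexicographic: a step of the union is a step of S or of T, possibly of both. *)
Lemma Acc_fsetU s (S T : esum s) :
  Acc (@rev_sum_red s) S -> Acc (@rev_sum_red s) T -> Acc (@rev_sum_red s) (S `|` T)%fset.
Proof.
move=> HS; elim: HS T => {}S HS IHS T HT; elim: HT => {}T HT IHT.
have splitA A X : A \in X -> X = (A |` (X `\ A))%fset by move=> AX; rewrite fsetD1K.
constructor=> _ [A [B [SA [AB HA E ->]]]].
have EB : B = ((S `\ A) `|` (T `\ A))%fset.
  by rewrite -fsetDUl E fsetU1K.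
have stepA X : A \in X -> sum_red X (SA `|` (X `\ A))%fset.
  move=> AX; exists A, (X `\ A)%fset, SA; split=> //; last exact: splitA.
  by rewrite !inE eqxx.
have sameA X : A \notin X -> (X `\ A)%fset = X by move=> AX; apply: mem_fsetD1.
rewrite EB; have [AS|AS] := boolP (A \in S); have [AT|AT] := boolP (A \in T).
(* [A] is reduced in both parts at once; idempotency supplies a copy of [SA] for each. *)
- have -> : (SA `|` (S `\ A `|` T `\ A) = (SA `|` S `\ A) `|` (SA `|` T `\ A))%fset.
    by rewrite fsetUACA fsetUid.
  by apply: IHS (stepA _ AS) _ _; apply: HT (stepA _ AT).
- by rewrite fsetUA (sameA T AT); apply: IHS (stepA _ AS) _ _; constructor.
- by rewrite fsetUCA (sameA S AS); apply: IHT (stepA _ AT).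
- by have := fset1U1 A B; rewrite -E inE (negbTE AS) (negbTE AT).
Qed.

Lemma Acc_fset0 s : Acc (@rev_sum_red s) fset0.
Proof.
by constructor=> T [A [B [SA [_ _ E _]]]]; have := fset1U1 A B; rewrite -E inE.
Qed.

Lemma Acc_elements s (S : esum s) :
  (forall A, A \in S -> Acc (@rev_sum_red s) [fset A]%fset) ->
  Acc (@rev_sum_red s) S.
Proof.
elim/finSet_rect: S => S IH HS; have [->|[A AS]] := fset_0Vmem S.
  exact: Acc_fset0.
rewrite -(fsetD1K AS); apply: Acc_fsetU; first exact: HS.
apply: IH => [|B]; first exact: fproperD1.
by rewrite in_fsetD1 => /andP[_ /HS].
Qed.

(** Induction on the size of a representative: a singleton reduces to a sum of smaller expressions,
    which is a union of accessible singletons. *)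
Lemma Acc_sum s (S : esum s) : Acc (@rev_sum_red s) S.
Proof.
apply: Acc_elements => A0 _; have [a <-] := pi_expr_surj A0.
have [n Hn] := ubnP (rsize (embed a)).
elim: n a Hn => [|n IH] a Hn; first by rewrite ltn0 in Hn.
constructor=> _ [A [B [SA [AB HA E ->]]]].
have EA : A = pi_expr a by apply/fset1P; rewrite E fset1U1.
(* This rests on [A] not being in [B]: otherwise [B] could be the singleton itself and the step
   would keep [A]. *)
have -> : B = fset0.
  apply/fsetP=> C; rewrite inE; apply/negP => BC.
  have /fset1P EC : C \in [fset pi_expr a]%fset by rewrite E inE BC orbT.
  by rewrite EA -EC BC in AB.
rewrite fsetU0; apply: Acc_elements => C CSA; rewrite EA in HA.
by have [c <- Hc] := red_rsize HA CSA; apply: IH; lia.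
Qed.

(** * Uniqueness of normal forms of sums *)

Definition sum_nf s (S : esum s) (N : rexpr s) : Prop :=
  exists2 a, pi_expr a \in S & has_nf (embed N) (embed a).

(** From [S] to [T] confluence is used, through [has_nf_reduct]; from [T] to [S] a step is put in
    front of the path. *)
Lemma sum_nf_red s (S T : esum s) N : sum_red S T -> (sum_nf S N <-> sum_nf T N).
Proof.
case=> A [B [SA [_ [a0 [S0 [Ea <- H0]]] -> ->]]]; have Hs := rred_step_embed H0.
split=> -[a Ha HN].
  have [E|aB] := fset1UP _ _ _ Ha; last by exists a; rewrite // inE aB orbT.
  have {}HN : has_nf (embed N) (embed a0).
    by apply: has_nf_canon HN; apply/pi_exprE; rewrite E.
  have [_ /pi_sum_embed[b -> Sb] Hb] := has_nf_reduct Hs HN.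
  by exists b; rewrite // inE Sb.
case: (fsetUP _ _ _ Ha) => [/mem_pi_sum[b Eb Sb]|aB]; last first.
  by exists a; rewrite // inE aB orbT.
exists a0; first by rewrite Ea fset1U1.
apply: has_nf_step Hs Sb _; apply: has_nf_canon HN.
by apply/pi_exprE.
Qed.

Lemma sum_nf_reds s (S T : esum s) N : clos_refl_trans _ (@sum_red s) S T ->
  (sum_nf S N <-> sum_nf T N).
Proof.
elim=> [X Y|X|X Y Z _ H1 _ H2]; [exact: sum_nf_red | by [] | exact: iff_trans H1 H2].
Qed.

Definition sum_normal s (S : esum s) : Prop := forall T, ~ sum_red S T.

(** Well-founded induction, with excluded middle deciding whether a sum reduces. *)
Lemma sum_normal_exists s (S : esum s) :
  exists2 T, clos_refl_trans _ (@sum_red s) S T & sum_normal T.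
Proof.
elim: (Acc_sum S) => {}S _ IH; have [[T ST]|NS] := classic (exists T, sum_red S T).
  have [U TU NU] := IH _ ST; exists U => //.
  exact: rt_trans (rt_step _ _ _ _ ST) TU.
by exists S; [exact: rt_refl | move=> T ST; apply: NS; exists T].
Qed.

Lemma sum_nf_normal s (S : esum s) N : sum_normal S -> (sum_nf S N <-> pi_expr N \in S).
Proof.
(* A reducible summand could be split off from the others and reduced, which would make the whole
   sum reducible. *)
move=> HS; have norm_in a : pi_expr a \in S -> normal (embed a).
  move=> aS X /step_embed_red[SA HA]; apply: HS.
  exists (pi_expr a), (S `\ pi_expr a)%fset, SA; split=> //; last by rewrite fsetD1K.
  by rewrite !inE eqxx.
split=> [[a aS HN]|NS]; last first.
  by exists N => //; apply: has_nf_normal; first exact: norm_in.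
suff -> : pi_expr N = pi_expr a by [].
by apply/pi_exprE; rewrite (normal_has_nf (norm_in _ aS) HN).
Qed.

Theorem theorem3p22 :
  (forall s : esort, strongly_normalizing (@sum_red s)) /\
  (forall s : esort, church_rosser (@sum_red s)).
Proof.
split=> s => [f Hf|A B1 B2 H1 H2].
  suff H S n : f n = S -> False by apply: (H (f 0) 0).
  elim: (Acc_sum S) n => {}S _ IH n E.
  by apply: IH (erefl (f n.+1)); rewrite /rev_sum_red -E.
have [C1 HC1 N1] := sum_normal_exists B1.
have [C2 HC2 N2] := sum_normal_exists B2.
(* The two normal forms have the same elements because membership in either is the same property of
   [A]. *)
suff EC : C1 = C2 by exists C1; split=> //; rewrite EC.
have nfC B C N : clos_refl_trans _ (@sum_red s) A B ->
    clos_refl_trans _ (@sum_red s) B C -> sum_normal C ->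
    (sum_nf A N <-> pi_expr N \in C).
  move=> AB BC NC; rewrite -(sum_nf_normal _ NC); apply: sum_nf_reds.
  exact: rt_trans AB BC.
apply/fsetP=> D; have [d <-] := pi_expr_surj D.
apply/idP/idP => [/(nfC _ _ d H1 HC1 N1)/(nfC _ _ d H2 HC2 N2)|] //.
by move=> /(nfC _ _ d H2 HC2 N2)/(nfC _ _ d H1 HC1 N1).
Qed.
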